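(* Let $0 < \alpha < \pi/2$ and let $C \subset \mathbb{R}^n$ be compact and nonempty. For $i = 1,2$, if $(w,v)$ is generated according to Probability Distribution $i$ with parameter $\alpha$, then $$\frac{E_i\,\mathrm{loss}(v,w)}{E_i\,\mathrm{range}(w)} = \frac{1-\cos\alpha}{2}.$$
   Context: For a nonempty compact set $C \subset \mathbb{R}^n$ and $v,w \in \mathbb{R}^n$, define $\max(v) := \max\{v^Tx : x \in C\}$, $\min(v) := \min\{v^Tx : x\in C\}$, $\mathrm{range}(v) := \max(v)-\min(v)$, and $\mathrm{loss}(v,w) := \max(w) - \min\{w^Tx : x \in C,\ v^Tx = \max(v)\}$. A standard Gaussian vector in $\mathbb{R}^n$ is a random vector whose components are independent standard Gaussian random variables, i.e. distributed as $N(0,I)$. Probability Distribution 1 (parameter $\alpha$): $w$ and $u$ are independent standard Gaussian vectors in $\mathbb{R}^n$, and $v := w\cos\alpha + u\sin\alpha$. Expectation with respect to this distribution is denoted $E_1$. Probability Distribution 2 (parameter $\alpha$): $\bar w$ and $\bar u$ are independent standard Gaussian vectors in $\mathbb{R}^n$, $\hat u := (I - \bar w\bar w^T/\bar w^T\bar w)\bar u$, $w := \bar w/\|\bar w\|$, $u := \hat u/\|\hat u\|$ (Euclidean norms; all the vectors are well-defined with probability one), and $v := w\cos\alpha + u\sin\alpha$. Expectation with respect to this distribution is denoted $E_2$. *)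

(* Defs.v *)
From HB Require Import structures.
From mathcomp Require Import all_boot all_order all_algebra.
From mathcomp Require Import all_classical all_reals all_analysis.

Set Implicit Arguments.
Unset Strict Implicit.
Unset Printing Implicit Defensive.

Import Order.TTheory GRing.Theory Num.Theory.
Import numFieldNormedType.Exports.

Local Open Scope classical_set_scope.
Local Open Scope ring_scope.

(* Vectors of R^n are row vectors, so v^T x is v *m x^T here. *)
Definition dot (R : realType) (n : nat) (v x : 'rV[R]_n) : R :=
  (v *m x^T) 0 0.

(* The library norm `|x| on 'rV[R]_n is the sup norm. *)
Definition enorm (R : realType) (n : nat) (x : 'rV[R]_n) : R :=
  Num.sqrt (dot x x).

(* For C compact and nonempty, the suprema and infima in maxC, minC and loss
   are attained. *)
Definition maxC (R : realType) (n : nat) (C : set 'rV[R]_n) (v : 'rV[R]_n) : R :=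
  sup [set dot v x | x in C].

Definition minC (R : realType) (n : nat) (C : set 'rV[R]_n) (v : 'rV[R]_n) : R :=
  inf [set dot v x | x in C].

Definition rangeC (R : realType) (n : nat) (C : set 'rV[R]_n) (v : 'rV[R]_n) : R :=
  maxC C v - minC C v.

Definition loss (R : realType) (n : nat) (C : set 'rV[R]_n)
    (v w : 'rV[R]_n) : R :=
  maxC C w - inf [set dot w x | x in C `&` [set x | dot v x = maxC C v]].

Section random_vectors.
Context (R : realType) (d : measure_display) (T : measurableType d).
Variables (P : probability T R) (n : nat).
Implicit Types X Y : T -> 'rV[R]_n.

Definition coords X : 'I_n -> T -> R := fun i t => X t 0 i.

(* Subfamilies are covered by taking B i = setT for the remaining indices. *)
Definition mutually_independent (F : 'I_n -> T -> R) : Prop :=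
  forall B : 'I_n -> set R, (forall i, measurable (B i)) ->
    P (\bigcap_i (F i @^-1` B i)) = (\prod_(i < n) P (F i @^-1` B i))%E.

(* g_sigma_preimage (coords X) is the sigma-algebra generated by X. *)
Definition independent_vectors X Y : Prop :=
  forall A B : set T,
    g_sigma_preimage (coords X) A -> g_sigma_preimage (coords Y) B ->
    P (A `&` B) = (P A * P B)%E.

(* The law is compared with N(0,1) on measurable sets only: P and normal_prob
   are total functions whose values elsewhere are irrelevant. *)
Definition standard_gaussian X : Prop :=
  [/\ forall i, measurable_fun setT (coords X i),
      forall i (B : set R), measurable B ->
        P (coords X i @^-1` B) = normal_prob 0 1 B
    & mutually_independent (coords X)].

Definition distribution1 (alpha : R) (w v : T -> 'rV[R]_n) : Prop :=
  exists u : T -> 'rV[R]_n,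
    [/\ standard_gaussian w, standard_gaussian u, independent_vectors w u
      & forall t, v t = cos alpha *: w t + sin alpha *: u t].

(* (I - a a^T / a^T a) b for a = wbar and b = ubar, transposed to row vectors
   (the matrix is symmetric). *)
Definition hat (a b : 'rV[R]_n) : 'rV[R]_n :=
  b *m (1%:M - (dot a a)^-1 *: (a^T *m a)).

(* The divisions are by nonzero numbers with probability one when 1 < n; on
   the exceptional event they take the library value 0^-1 = 0. *)
Definition distribution2 (alpha : R) (w v : T -> 'rV[R]_n) : Prop :=
  exists wbar ubar : T -> 'rV[R]_n,
    let uhat t := hat (wbar t) (ubar t) in
    let u t := (enorm (uhat t))^-1 *: uhat t in
    [/\ standard_gaussian wbar, standard_gaussian ubar,
        independent_vectors wbar ubar,
        forall t, w t = (enorm (wbar t))^-1 *: wbar t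
      & forall t, v t = cos alpha *: w t + sin alpha *: u t].

End random_vectors.

(* Main.v *)
(** Write sigma for the support function maxC C. By Danskin's theorem, loss(v, w) - sigma(w) is
    the one-sided derivative of sigma at v in the direction -w, that is, the limit of the
    quotients (sigma(v - h w) - sigma(v)) / h, which are dominated by a multiple of |w|. Under
    both distributions a w + b u has, for the purpose of integrating positively homogeneous
    Lipschitz functions, the same law as sqrt(a^2 + b^2) w. Hence the expected quotient is
    ((sqrt((cos alpha - h)^2 + sin^2 alpha) - 1) / h) E sigma(w), which tends to
    - cos alpha E sigma(w), whereas E range(w) = E sigma(w) + E sigma(-w) = 2 E sigma(w).

    The law of a w + b u is obtained from the invariance of a Gaussian family under Givens
    rotations (a plane rotation is a product of three shears, which preserve Lebesgue measure).
    For Distribution 2 this shows that X = a w + b u is isotropic with constant norm, and two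
    isotropic unit vectors X, Y have the same law: integrate f against a kernel k(X . Y')
    concentrated near X = Y', where Y' is a copy of Y independent of X, and apply Fubini. *)

Require Import Defs.
From mathcomp Require Import all_boot all_order all_algebra.
From mathcomp Require Import all_classical all_reals all_analysis.
From mathcomp Require Import measurable_realfun.
From mathcomp Require Import ring lra.
Set Implicit Arguments.
Unset Strict Implicit.
Unset Printing Implicit Defensive.
Import Order.TTheory GRing.Theory Num.Theory.
Import numFieldNormedType.Exports.
Import HBNNSimple.
Local Open Scope classical_set_scope.
Local Open Scope ring_scope.

(* Order.TTheory also exports lemmas called maxC and minC. *)
Local Notation maxC := Defs.maxC.
Local Notation minC := Defs.minC.

(** * Rotation invariance of Gaussian families *)

Section plane.
Context (R : realType).
Notation mu := (@lebesgue_measure R).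
Local Open Scope ereal_scope.

(** The loss depends on the pair (v, w) and need not be continuous, so it cannot be compared
    directly through the law of a single vector. The quotients remove this obstacle: v - h w is
    again a combination of w and u, so that only the law of one combination at a time enters, never
    the joint law. They also make the loss measurable, as a pointwise limit.

    For Distribution 2 no uniform measure on the sphere is constructed. The kernel masses of X and Y
    agree by Fubini, and they can be cancelled: they are finite, and positive because a Gaussian
    vector charges every ball. Where the kernel is positive, |X - Y'|^2 = 2 - 2 X . Y' is below 2e,
    so a Lipschitz f hardly changes. Isotropy is needed only for the averages y -> E k(X . y).
    Givens rotations carry y to |y| times a basis vector, which takes two coordinates, since a
    rotation must be available to correct the sign. The frame is orthonormal only almost surely,
    whence a modification on a null set before the kernel argument applies. *)

Lemma lebesgue_measure_shift (a : R) (A : set R) : measurable A ->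
  mu ((fun x => (x + a)%R) @^-1` A) = mu A.
Proof.
move=> mA.
pose phi := fun x : measurableTypeR R => (x + a)%R : measurableTypeR R.
have mphi : measurable_fun [set: measurableTypeR R] phi by exact: measurable_funD.
rewrite [RHS](@lebesgue_measure_unique _ (pushforward mu phi))//.
move=> X [[x y] _ <-] /=.
rewrite /pushforward /=.
have -> : (fun z => (z + a)%R) @^-1` [set` `]x, y]%R] = [set` `](x - a)%R, (y - a)%R]%R].
  by apply/seteqP; split => z /=; rewrite !in_itv/= ltrBlDr lerBrDr.
rewrite !lebesgue_measure_itv/= !lte_fin ltrD2r.
by case: ifPn => // _; rewrite -!EFinD; congr (_%:E); ring.
Qed.

Lemma ge0_integral_shift (a : R) (f : R -> \bar R) : measurable_fun setT f ->
  (forall x, 0 <= f x) -> \int[mu]_x f (x + a)%R = \int[mu]_x f x.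
Proof.
move=> mf f0.
pose phi := fun x : measurableTypeR R => (x + a)%R : measurableTypeR R.
have mphi : measurable_fun [set: measurableTypeR R] phi by exact: measurable_funD.
have := @ge0_integral_pushforward _ _ _ _ R phi mphi mu setT f measurableT mf (fun y _ => f0 y).
rewrite preimage_setT => <-.
apply: eq_measure_integral => A mA _.
exact: lebesgue_measure_shift.
Qed.

(** The density defines [normal_prob] on sets, that is, on indicators; linearity gives simple
    functions, and monotone convergence gives nonnegative measurable functions. *)
Lemma ge0_integral_normal_prob (m s : R) (f : measurableTypeR R -> \bar R) :
  measurable_fun setT f -> (forall x, 0 <= f x) ->
  \int[normal_prob m s]_x f x = \int[mu]_x (f x * (normal_pdf m s x)%:E).
Proof.
move=> mf f0; have p0 x : 0 <= (normal_pdf m s x)%:E by rewrite lee_fin normal_pdf_ge0.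
have mp : measurable_fun setT (fun x => (normal_pdf m s x)%:E).
  by apply/measurable_EFinP; exact: measurable_normal_pdf.
pose f_ := nnsfun_approx measurableT mf.
have indE (A : set R) : measurable A -> normal_prob m s A =
    \int[mu]_x ((\1_A x)%:E * (normal_pdf m s x)%:E).
  move=> mA; rewrite /normal_prob integral_mkcond; apply: eq_integral => x _.
  by rewrite patchE indicE; case: ifP => _; rewrite ?mul1e ?mul0e.
have simple (g : {nnsfun _ >-> R}) :
    \int[normal_prob m s]_x (g x)%:E = \int[mu]_x ((g x)%:E * (normal_pdf m s x)%:E).
  under [LHS]eq_integral do rewrite fimfunE -fsumEFin//.
  rewrite [LHS]ge0_integral_fsum//; last 2 first.
  - by move=> r; exact/measurable_EFinP/measurableT_comp.
  - by move=> r x _; rewrite EFinM nnfun_muleindic_ge0.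
  under [RHS]eq_integral.
    move=> x _; rewrite fimfunE -fsumEFin// ge0_mule_fsuml; last first.
      by move=> r; rewrite EFinM nnfun_muleindic_ge0.
    over.
  rewrite [RHS]ge0_integral_fsum//; last 2 first.
  - move=> r; apply: emeasurable_funM => //.
    by apply/measurable_EFinP; do 2 apply/measurableT_comp => //.
  - by move=> r x _; apply: mule_ge0 => //; rewrite EFinM nnfun_muleindic_ge0.
  apply: eq_fsbigr => r rg.
  rewrite integralZl_indic_nnsfun//= integral_indic//= setIT indE; last first.
    by apply: (measurable_funPTI g); exact: measurable_set1.
  rewrite -ge0_integralZl//.
  - by apply: eq_integral => x _; rewrite EFinM muleA.
  - by apply: emeasurable_funM => //; exact/measurable_EFinP/measurable_indic.
  - by move=> x _; apply: mule_ge0 => //; rewrite lee_fin indicE.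
  - by rewrite lee_fin; move: rg; rewrite inE => -[x _ <-]; exact: fun_ge0.
have -> : \int[normal_prob m s]_x f x =
    limn (fun n => \int[normal_prob m s]_x (f_ n x)%:E).
  rewrite -monotone_convergence//=.
  - by apply: eq_integral => x _; apply/esym/cvg_lim => //=; exact: cvg_nnsfun_approx.
  - by move=> n; apply/measurable_EFinP; exact: (measurable_funPT (f_ n)).
  - by move=> n x _; rewrite lee_fin.
  - by move=> x _ i j ij; rewrite lee_fin; exact/lefP/nd_nnsfun_approx.
under eq_fun do rewrite simple.
rewrite -monotone_convergence//=.
- apply: eq_integral => x _; apply/cvg_lim => //=.
  apply: cvgeZr => //; exact: cvg_nnsfun_approx.
- by move=> n; apply: emeasurable_funM => //; exact/measurable_EFinP/measurable_funTS.
- by move=> n x _; rewrite mule_ge0// lee_fin.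
- move=> x _ i j ij; apply: lee_wpmul2r => //.
  by rewrite lee_fin; exact/lefP/nd_nnsfun_approx.
Qed.

End plane.

(** * Rotations of the plane *)

Section rotation.
Context (R : realType).
Notation mu := (@lebesgue_measure R).
Notation RR := (measurableTypeR R).
Notation gauss := (@normal_prob R 0 1).
Local Open Scope ereal_scope.

Lemma ge0_integral_shear2 (t : R) (F : RR * RR -> \bar R) :
  measurable_fun setT F -> (forall p, 0 <= F p) ->
  \int[mu]_x \int[mu]_y F (x, y + t * x)%R = \int[mu]_x \int[mu]_y F (x, y).
Proof.
move=> mF F0; apply: eq_integral => x _.
apply: (ge0_integral_shift (t * x)%R (f := fun y => F (x, y))) => //.
by apply: measurableT_comp => //; exact: measurable_pair1.
Qed.

Lemma ge0_integral_shear1 (t : R) (F : RR * RR -> \bar R) :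
  measurable_fun setT F -> (forall p, 0 <= F p) ->
  \int[mu]_x \int[mu]_y F (x + t * y, y)%R = \int[mu]_x \int[mu]_y F (x, y).
Proof.
move=> mF F0.
have mS : measurable_fun [set: RR * RR] (fun p : RR * RR => ((p.1 + t * p.2)%R : RR, p.2)).
  apply: measurable_fun_pair => //; apply: measurable_funD => //.
  exact: measurable_funM.
rewrite [LHS](fubini_tonelli (m1 := mu) (m2 := mu) (fun p => F (p.1 + t * p.2, p.2)%R)
  (measurableT_comp mF mS) (fun p => F0 _)).
rewrite [RHS](fubini_tonelli (m1 := mu) (m2 := mu) F mF F0).
apply: eq_integral => y _.
apply: (ge0_integral_shift (t * y)%R (f := fun x => F (x, y))) => //.
by apply: measurableT_comp => //; exact: measurable_pair2.
Qed.

(** For c = cos(theta) and s = sin(theta), [t] is tan(theta / 2). The composition of the shears with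
    parameters t, -s, t collapses by t s = 1 - c and t (1 + c) = s. *)
Lemma shears_rot (c s x y : R) (t := ((1 - c) / s)%R) : (s != 0 -> c ^+ 2 + s ^+ 2 = 1 ->
  x + t * y + t * (y + - s * (x + t * y)) = c * x + s * y /\
  y + - s * (x + t * y) = - s * x + c * y)%R.
Proof.
move=> s0 cs.
have ts : (t * s = 1 - c)%R by rewrite /t divfK.
have tc : (t * (1 + c) = s)%R.
  by rewrite /t mulrAC (_ : (1 - c) * (1 + c) = s * s)%R ?mulfK//;
    transitivity (1 - c ^+ 2)%R; [ring|rewrite -cs; ring].
split.
- transitivity (x - t * s * x + (t * (1 + c) + t * (1 - t * s - c)) * y)%R; first by ring.
  by rewrite ts tc; ring.
- transitivity (- s * x + (1 - t * s) * y)%R; first by ring.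
  by rewrite ts; ring.
Qed.

(* A rotation is a product of three shears, each of which preserves Lebesgue measure by Fubini. *)
Lemma ge0_integral_rot (c s : R) (F : RR * RR -> \bar R) :
  s != 0%R -> (c ^+ 2 + s ^+ 2 = 1)%R ->
  measurable_fun setT F -> (forall p, 0 <= F p) ->
  \int[mu]_x \int[mu]_y F (c * x + s * y, - s * x + c * y)%R =
  \int[mu]_x \int[mu]_y F (x, y).
Proof.
move=> s0 cs mF F0; pose t := ((1 - c) / s)%R.
have mS1 : measurable_fun [set: RR * RR] (fun p : RR * RR => ((p.1 + t * p.2)%R : RR, p.2)).
  apply: measurable_fun_pair => //; apply: measurable_funD => //.
  exact: measurable_funM.
have mS2 : measurable_fun [set: RR * RR] (fun p : RR * RR => (p.1, (p.2 + - s * p.1)%R : RR)).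
  apply: measurable_fun_pair => //; apply: measurable_funD => //.
  exact: measurable_funM.
pose F1 p := F ((p.1 + t * p.2)%R, p.2).
pose F2 p := F1 (p.1, (p.2 + - s * p.1)%R).
have mF1 : measurable_fun setT F1 by exact: (measurableT_comp mF mS1).
have mF2 : measurable_fun setT F2 by exact: (measurableT_comp mF1 mS2).
rewrite -[RHS](@ge0_integral_shear1 t F mF F0)
  -[RHS](@ge0_integral_shear2 (- s)%R F1 mF1 (fun p => F0 _)).
rewrite -[RHS](@ge0_integral_shear1 t F2 mF2 (fun p => F0 _)).
apply: eq_integral => x _; apply: eq_integral => y _.
rewrite /F2 /F1 /=; have [-> ->] := shears_rot x y s0 cs; exact: erefl.
Qed.

Lemma measurable_rot2 (c s : R) : measurable_fun [set: RR * RR] (fun p : RR * RR =>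
    ((c * p.1 + s * p.2)%R : RR, (- s * p.1 + c * p.2)%R : RR)).
Proof.
by apply: measurable_fun_pair => //; apply: measurable_funD => //; exact: measurable_funM.
Qed.

(** Written as Lebesgue integrals, both sides have the density of the product Gaussian, which
    depends on x^2 + y^2 only and is therefore unchanged by the rotation. *)
Lemma gauss_rot_neq0 (c s : R) (B C : set RR) :
  s != 0%R -> (c ^+ 2 + s ^+ 2 = 1)%R -> measurable B -> measurable C ->
  (gauss \x gauss) [set p | B (c * p.1 + s * p.2)%R /\ C (- s * p.1 + c * p.2)%R]
  = gauss B * gauss C.
Proof.
move=> s0 cs mB mC; rewrite -[RHS](product_measure1E gauss gauss mB mC).
have main (E : set (RR * RR)) : measurable E ->
    (gauss \x gauss) E = \int[mu]_x \int[mu]_y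
      ((\1_E (x, y))%:E * (normal_pdf 0 1 x * normal_pdf 0 1 y)%:E).
  move=> mE; rewrite -[E in LHS]setIT -integral_indic//.
  rewrite fubini_tonelli1//=; last exact/measurable_EFinP/measurable_indic.
  rewrite ge0_integral_normal_prob//=; last 2 first.
  - apply: (@measurable_fun_fubini_tonelli_F _ _ _ _ _ gauss (fun p => (\1_E p)%:E)) => //.
    exact/measurable_EFinP/measurable_indic.
  - by move=> x; apply: integral_ge0 => y _.
  apply: eq_integral => x _; rewrite /fubini_F/=.
  have mEx : measurable_fun [set: RR] (fun y : RR => (\1_E (x, y) : R)%:E).
    apply/measurable_EFinP; apply: measurableT_comp; first exact: measurable_indic.
    exact: measurable_pair1.
  have mp : measurable_fun [set: RR] (fun y : RR => (normal_pdf 0 1 y)%:E).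
    by apply/measurable_EFinP; exact: measurable_normal_pdf.
  have p0 y : 0 <= (normal_pdf 0 1 y)%:E by rewrite lee_fin normal_pdf_ge0.
  rewrite ge0_integral_normal_prob// -ge0_integralZr//.
  - by apply: eq_integral => y _; rewrite EFinM -muleA [_%:E * (_ x)%:E]muleC.
  - exact: emeasurable_funM.
  - by move=> y _; apply: mule_ge0.
have mE : measurable (B `*` C) by exact: measurableX.
set E := [set p | _].
have EE : E = (fun p : RR * RR => ((c * p.1 + s * p.2)%R : RR, (- s * p.1 + c * p.2)%R : RR))
    @^-1` (B `*` C) by [].
have mE' : measurable E by rewrite EE -[_ @^-1` _]setTI; exact: measurable_rot2.
rewrite [LHS](main _ mE') [RHS](main _ mE).
pose G (p : RR * RR) := (\1_(B `*` C) p : R)%:E * (normal_pdf 0 1 p.1 * normal_pdf 0 1 p.2)%:E.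
have mG : measurable_fun setT G.
  apply: emeasurable_funM.
    by apply/measurable_EFinP; exact: measurable_indic.
  apply/measurable_EFinP; apply: measurable_funM.
    by apply: measurableT_comp => //; exact: measurable_normal_pdf.
  by apply: measurableT_comp => //; exact: measurable_normal_pdf.
have G0 p : 0 <= G p by rewrite mule_ge0// lee_fin ?mulr_ge0 ?normal_pdf_ge0.
rewrite -[RHS](ge0_integral_rot s0 cs mG G0).
apply: eq_integral => x _; apply: eq_integral => y _; rewrite /G; congr (_ * _).
rewrite !normal_pdfE ?oner_neq0// /normal_fun; congr (_%:E).
rewrite !subr0 mulrACA [RHS]mulrACA; congr *%R; rewrite -!expRD; congr expR.
rewrite -!mulrDl; congr (_ / _)%R.
transitivity (- ((c ^+ 2 + s ^+ 2) * (x ^+ 2 + y ^+ 2)))%R; last by rewrite /=; ring.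
by rewrite cs; ring.
Qed.

End rotation.

(** The index type is arbitrary so that the same rotation acts on the coordinates of one vector and,
    over a sum type, on those of a pair of vectors. *)
Definition givens (R : realType) (I : eqType) (i j : I) (c s : R) (z : I -> R) : I -> R :=
  fun k => if k == i then c * z i + s * z j
           else if k == j then - s * z i + c * z j else z k.

(** Normality and independence are merged into one product formula over boxes. With a sum as index
    type, a pair of independent Gaussian vectors is a single family. *)
Definition iid_normal d (T : measurableType d) (R : realType) (P : probability T R)
    (I : finType) (Z : T -> I -> R) : Prop :=
  (forall i, measurable_fun setT (fun t => Z t i)) /\
  forall B : I -> set R, (forall i, measurable (B i)) ->
    P [set t | forall i, B i (Z t i)] = (\prod_i normal_prob 0 1 (B i))%E.

Section iid.
Context (R : realType).
Notation RR := (measurableTypeR R).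
Notation gauss := (@normal_prob R 0 1).

Lemma measure_rect_unique (m1 m2 : {measure set (RR * RR) -> \bar R}) :
  (m1 setT < +oo)%E ->
  (forall A B, measurable A -> measurable B -> m1 (A `*` B) = m2 (A `*` B)) ->
  forall E, measurable E -> m1 E = m2 E.
Proof.
move=> m1oo m12 E; rewrite measurable_prod_measurableType => mE.
apply: (@g_sigma_algebra_measure_unique _ _ _
  [set A `*` B | A in measurable & B in measurable] _ (fun=> setT) _ _ m1 m2) => //.
- by move=> _ [A mA [B mB <-]]; exact: measurableX.
- by move=> _; exists setT => //; exists setT => //; exact: setXTT.
- by apply/seteqP; split => // x _; exists 0%N.
- move=> _ _ [A mA [B mB <-]] [A' mA' [B' mB' <-]].
  exists (A `&` A'); first exact: measurableI.
  by exists (B `&` B'); [exact: measurableI|rewrite setXI].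
- by move=> _ [A mA [B mB <-]]; exact: m12.
Qed.

Lemma measurable_forall d (T : measurableType d) (I : finType) (Z : T -> I -> R)
    (B : I -> set R) : (forall i, measurable_fun setT (fun t => Z t i)) ->
  (forall i, measurable (B i)) -> measurable [set t | forall i, B i (Z t i)].
Proof.
move=> mZ mB.
have -> : [set t | forall i, B i (Z t i)] = \bigcap_(i in [set: I]) ((fun t => Z t i) @^-1` B i).
  by apply/seteqP; split => t /= h i; [move=> _; exact: h|exact: (h i Logic.I)].
apply: fin_bigcap_measurable => // i _; rewrite -[X in measurable X]setTI; exact: mZ.
Qed.

Context d (T : measurableType d) (P : probability T R) (I : finType).
Implicit Type Z : T -> I -> R.

Lemma measurable_givens Z i j c s : (forall k, measurable_fun setT (fun t => Z t k)) ->
  forall k, measurable_fun setT (fun t => givens i j c s (Z t) k).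
Proof.
move=> mZ k; rewrite /givens; case: (k == i).
  by apply: measurable_funD; exact: measurable_funM.
by case: (k == j); [apply: measurable_funD; exact: measurable_funM|exact: mZ].
Qed.

(** The events imposed on the coordinates other than [i] and [j] form [E0]. On [E0] the law of
    ([Z i], [Z j]) is [q] times the product Gaussian on rectangles, hence on all measurable sets of
    the plane, in particular on the rotated rectangle [S]. *)
Lemma iid_normal_givens_neq0 Z i j c s : i != j -> s != 0 -> c ^+ 2 + s ^+ 2 = 1 ->
  iid_normal P Z -> iid_normal P (fun t => givens i j c s (Z t)).
Proof.
move=> ij s0 cs [mZ PZ]; split; first exact: measurable_givens.
move=> B mB.
pose B' X Y := fun k => if k == i then X else if k == j then Y else B k.
pose E0 := [set t | forall k, B' setT setT k (Z t k)].
have mB' X Y : measurable X -> measurable Y -> forall k, measurable (B' X Y k).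
  by move=> mX mY k; rewrite /B'; case: ifP => // _; case: ifP.
have mE0 : measurable E0 by apply: measurable_forall => //; exact: mB'.
pose q := (\prod_(k | (k != i) && (k != j)) gauss (B k))%E.
have PB' X Y : measurable X -> measurable Y ->
    P [set t | forall k, B' X Y k (Z t k)] = (gauss X * gauss Y * q)%E.
  move=> mX mY; rewrite PZ; last exact: mB'.
  rewrite (bigD1 i)//= (bigD1 j)/=; last by rewrite eq_sym.
  rewrite /B' eqxx eq_sym (negbTE ij) eqxx muleA; congr (_ * _)%E.
  by apply: eq_bigr => k /andP[/negbTE -> /negbTE ->].
have qE : q = P E0 by rewrite PB'//= !probability_setT !mul1e.
have q0 : 0 <= fine q by rewrite qE fine_ge0.
have qfin : q \is a fin_num by rewrite qE fin_num_measure.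
have qN : ((NngNum q0)%:num)%:E = q by rewrite [LHS]fineK.
have mW : measurable_fun [set: T] (fun t => (Z t i : RR, Z t j : RR)).
  by apply: measurable_fun_pair; exact: mZ.
pose m1 := pushforward (mrestr P mE0) (fun t => (Z t i : RR, Z t j : RR)).
pose m2 := mscale (NngNum q0) (gauss \x gauss)%E.
pose S := [set p : RR * RR | B i (c * p.1 + s * p.2) /\ B j (- s * p.1 + c * p.2)].
have mS : measurable S.
  have mBB : measurable ((B i : set RR) `*` (B j : set RR)) by apply: measurableX; exact: mB.
  by have := measurable_rot2 c s measurableT mBB; rewrite setTI.
have : m1 S = m2 S.
  apply: measure_rect_unique => //.
    rewrite /m1/= /pushforward/= /mrestr.
    by rewrite preimage_setT setTI -qE ltey_eq qfin.
  move=> X Y mX mY.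
  rewrite /m1 /m2 /= /pushforward /mrestr /mscale /= product_measure1E// qN.
  rewrite muleC -PB'//; congr (P _); apply/seteqP; split => t /=.
    move=> [[Xt Yt] E0t] k; have := E0t k; rewrite /B'.
    by case: eqP => [->//|_]; case: eqP => [->|].
  move=> h; split; last first.
    by move=> k; have := h k; rewrite /B'; case: eqP => // _; case: eqP.
  by have := h i; have := h j; rewrite /B' !eqxx [j == i]eq_sym (negbTE ij).
rewrite /m1 /m2 /= /pushforward /mrestr /mscale /=.
rewrite (gauss_rot_neq0 s0 cs (mB i) (mB j)) fineK// => m12.
rewrite (bigD1 i)//= (bigD1 j)/=; last by rewrite eq_sym.
rewrite muleA [RHS]muleC -[RHS]m12; congr (P _); apply/seteqP; split => t /=.
  move=> h; split.
    by have := h i; have := h j; rewrite /givens !eqxx [j == i]eq_sym (negbTE ij).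
  by move=> k; have := h k; rewrite /B' /givens; case: eqP => // _; case: eqP.
move=> [[hi hj] E0t] k; have := E0t k; rewrite /B' /givens.
by case: eqP => [->//|_]; case: eqP => [->|].
Qed.

Lemma iid_normal_givens Z i j c s : i != j -> c ^+ 2 + s ^+ 2 = 1 ->
  iid_normal P Z -> iid_normal P (fun t => givens i j c s (Z t)).
Proof.
move=> ij cs iZ; have [s0|] := eqVneq s 0; last by move=> s0; exact: iid_normal_givens_neq0.
have cc : c ^+ 2 = 1 by rewrite -cs s0 expr0n addr0.
have c0 : - c != 0 by rewrite oppr_eq0 -sqrf_eq0 cc oner_eq0.
(* For s = 0 the shear parameter is undefined; here c is 1 or -1, and the map is a product of two
   quarter turns, which have nonzero sine. *)
have -> : (fun t => givens i j c s (Z t)) = (fun t => givens i j 0 1 (givens i j 0 (- c) (Z t))).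
  apply/funext => t; apply/funext => k; rewrite /givens s0 !eqxx [j == i]eq_sym (negbTE ij).
  by case: eqP => // _; [ring|case: eqP => // _; ring].
apply: iid_normal_givens_neq0; rewrite ?oner_eq0//; first by ring.
by apply: iid_normal_givens_neq0 => //; rewrite sqrrN cc; ring.
Qed.

End iid.

(** * Laws of Gaussian families *)

(** Generators of the product sigma-algebra. They are stable under intersection, so the product
    formula in [iid_normal] determines the whole law of a family. *)
Definition boxes (R : realType) (I : finType) : set (set (I -> R)) :=
  [set A | exists2 B : I -> set R, (forall i, measurable (B i)) &
                                   A = [set z | forall i, B i (z i)]].
Arguments boxes : clear implicits.

Notation funspace R I := (g_sigma_algebraType (boxes R I)).

Section law.
Context (R : realType) (I : finType).
Notation gauss := (@normal_prob R 0 1).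

Lemma measurable_funspace_coord (i : I) :
  measurable_fun [set: funspace R I] (fun z : funspace R I => z i).
Proof.
move=> _ Y mY; apply: sub_sigma_algebra; rewrite setTI.
exists (fun k => if k == i then Y else setT); first by move=> k; case: ifP.
apply/seteqP; split => z /=; first by move=> Yz k; case: eqP => // ->.
by move=> /(_ i); rewrite eqxx.
Qed.

Context d (T : measurableType d) (P : probability T R) (Z : T -> I -> R).

Lemma measurable_to_funspace : (forall i, measurable_fun setT (fun t => Z t i)) ->
  measurable_fun setT (Z : T -> funspace R I).
Proof.
move=> mZ; apply: (@measurability _ _ _ (funspace R I) _ _ (boxes R I)) => // _ [_ [B mB ->] <-].
by rewrite setTI; exact: measurable_forall.
Qed.

Context d' (T' : measurableType d') (P' : probability T' R) (Z' : T' -> I -> R).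
Hypotheses (iZ : iid_normal P Z) (iZ' : iid_normal P' Z').

(** The two families may live on different probability spaces; this allows a comparison with a
    family resampled on a product space. *)
Lemma iid_normal_law (E : set (funspace R I)) : measurable E ->
  P (Z @^-1` E) = P' (Z' @^-1` E).
Proof.
move=> mE; have mZ := measurable_to_funspace iZ.1.
have mZ' : measurable_fun setT (Z' : T' -> funspace R I).
  apply: (@measurability _ _ _ (funspace R I) _ _ (boxes R I)) => // _ [_ [B mB ->] <-].
  by rewrite setTI; apply: measurable_forall => //; exact: iZ'.1.
have := @g_sigma_algebra_measure_unique _ R (funspace R I) (boxes R I) _ (fun=> setT) _ _
  (pushforward P (Z : T -> funspace R I)) (pushforward P' (Z' : T' -> funspace R I)).
apply => //.
- by move=> A bA; exact: sub_sigma_algebra.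
- by move=> _; exists (fun=> setT) => //; apply/seteqP; split.
- by apply/seteqP; split => // x _; exists 0%N.
- move=> _ _ [B mB ->] [B' mB' ->]; exists (fun i => B i `&` B' i).
    by move=> i; exact: measurableI.
  apply/seteqP; split => z /=; first by move=> [zB zB'] i; split.
  by move=> zBB'; split => i; have [] := zBB' i.
- by move=> _ [B mB ->]; rewrite /= /pushforward iZ.2// iZ'.2.
- by move=> _; rewrite /= /pushforward preimage_setT probability_setT ltry.
Qed.

(** No integrability is assumed: the integrals of the positive and negative parts agree
    separately. *)
Lemma iid_normal_integral (F : funspace R I -> \bar R) : measurable_fun setT F ->
  (\int[P]_t F (Z t) = \int[P']_t F (Z' t))%E.
Proof.
move=> mF; have mZ := measurable_to_funspace iZ.1.
have mZ' : measurable_fun setT (Z' : T' -> funspace R I).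
  apply: (@measurability _ _ _ (funspace R I) _ _ (boxes R I)) => // _ [_ [B mB ->] <-].
  by rewrite setTI; apply: measurable_forall => //; exact: iZ'.1.
have ge0 (G : funspace R I -> \bar R) : measurable_fun setT G -> (forall z, 0 <= G z)%E ->
    (\int[P]_t G (Z t) = \int[P']_t G (Z' t))%E.
  move=> mG G0.
  have := ge0_integral_pushforward mZ P measurableT mG (fun y _ => G0 y).
  have := ge0_integral_pushforward mZ' P' measurableT mG (fun y _ => G0 y).
  rewrite !preimage_setT => <- <-; apply: eq_measure_integral => E mE _.
  exact: iid_normal_law.
rewrite integralE [RHS]integralE.
have posE S (W : S -> funspace R I) : (fun t => F (W t))^\+%E = (fun t => F^\+%E (W t)).
  by apply/funext => t; rewrite !funeposE.
have negE S (W : S -> funspace R I) : (fun t => F (W t))^\-%E = (fun t => F^\-%E (W t)).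
  by apply/funext => t; rewrite !funenegE.
rewrite (posE _ Z) (posE _ Z') (negE _ Z) (negE _ Z').
have -> := ge0 _ (measurable_funepos mF) (fun z => funepos_ge0 F z).
have -> := ge0 _ (measurable_funeneg mF) (fun z => funeneg_ge0 F z). by [].
Qed.

End law.

Section families.
Context (R : realType) d (T : measurableType d) (P : probability T R).
Notation gauss := (@normal_prob R 0 1).
Local Open Scope ereal_scope.

Lemma iid_normal_inl (I J : finType) (Z : T -> I + J -> R) :
  iid_normal P Z -> iid_normal P (fun t i => Z t (inl i)).
Proof.
move=> [mZ PZ]; split=> [i|B mB]; first exact: mZ.
pose B' (k : I + J) := if k is inl i then B i else setT.
have -> : [set t | forall i, B i (Z t (inl i))] = [set t | forall k, B' k (Z t k)].
  apply/seteqP; split => t /= h; first by move=> [i|j] /=.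
  by move=> i; exact: (h (inl i)).
rewrite PZ; last by move=> [i|j] /=.
by rewrite big_sumType/= [X in _ * X]big1 ?mule1// => j _; rewrite probability_setT.
Qed.

(** Moving the coordinates in [S] to an independent copy makes independence visible as a product
    measure: the remaining coordinates can be frozen and the others integrated alone. *)
Lemma iid_normal_resample (I : finType) (Z : T -> I -> R) (S : pred I) :
  iid_normal P Z ->
  iid_normal (P \x P) (fun p i => if S i then Z p.2 i else Z p.1 i).
Proof.
move=> [mZ PZ]; split=> [i|B mB].
  by case: (S i); apply: (measurableT_comp (mZ i)).
pose B1 i := if S i then setT else B i; pose B2 i := if S i then B i else setT.
have mB1 i : measurable (B1 i) by rewrite /B1; case: (S i).
have mB2 i : measurable (B2 i) by rewrite /B2; case: (S i).
have -> : [set p : T * T | forall i, B i (if S i then Z p.2 i else Z p.1 i)] =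
    [set t | forall i, B1 i (Z t i)] `*` [set t | forall i, B2 i (Z t i)].
  apply/seteqP; split => -[t t'] /=.
    by move=> h; split => i; have := h i; rewrite /B1 /B2; case: (S i).
  by move=> [h1 h2] i; have := h1 i; have := h2 i; rewrite /B1 /B2; case: (S i).
rewrite [LHS](product_measure1E P P); last 2 first.
- exact: measurable_forall.
- exact: measurable_forall.
transitivity (P [set t | forall i, B1 i (Z t i)] * P [set t | forall i, B2 i (Z t i)]); first by [].
rewrite (PZ B1 mB1) (PZ B2 mB2) -big_split/=; apply: eq_bigr => i _; rewrite /B1 /B2.
by case: (S i); rewrite probability_setT ?mul1e ?mule1.
Qed.

Lemma normal_prob_set1 (a : R) : gauss [set a] = 0.
Proof.
have := @normal_prob_dominates R 0 1.
move=> /null_content_dominatesP; apply; first exact: measurable_set1.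
exact: lebesgue_measure_set1.
Qed.

(** On the interval the density is at least its value at [M], the larger of |a| and |b|. *)
Lemma normal_prob_itv_gt0 (a b : R) : (a < b)%R -> 0 < gauss `]a, b[%classic.
Proof.
move=> ab; pose M : R := Num.max `|a|%R `|b|%R.
apply: (@lt_le_trans _ _ (\int[lebesgue_measure]_(x in `]a, b[) (normal_pdf 0 1 M)%:E)).
  rewrite integral_cst//= lebesgue_measure_itv/= lte_fin ab -EFinD -EFinM lte_fin.
  rewrite mulr_gt0 ?subr_gt0//.
  by rewrite normal_pdfE ?oner_neq0// mulr_gt0 ?expR_gt0// normal_peak_gt0// oner_neq0.
apply: ge0_le_integral => //=.
- by move=> x _; rewrite lee_fin normal_pdf_ge0.
- by apply/measurable_EFinP/measurable_funTS; exact: measurable_normal_pdf.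
move=> x; rewrite in_itv/= => /andP[ax xb].
rewrite lee_fin !normal_pdfE ?oner_neq0// ler_wpM2l ?normal_peak_ge0//.
rewrite /normal_fun ler_expR !subr0 ler_pM2r ?invr_gt0 ?pmulrn_lgt0 ?expr1n ?ltr01//.
have xM : (`|x| <= M)%R.
  rewrite /M le_max; apply/orP; have [x0|x0] := lerP 0%R x; [right|left].
    by rewrite (ger0_norm x0) (le_trans (ltW xb))// ler_norm.
  by rewrite (ltr0_norm x0) -normrN (le_trans _ (ler_norm _))// lerN2 ltW.
have M0 : (0 <= M)%R by exact: le_trans xM.
by rewrite lerN2 -[leLHS]real_normK ?num_real// ler_sqr ?nnegrE.
Qed.

Lemma iid_normal_ball_gt0 (I : finType) (Z : T -> I -> R) (y : I -> R) (e : R) :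
  (0 < e)%R -> iid_normal P Z -> 0 < P [set t | forall i, (`|Z t i - y i| < e)%R].
Proof.
move=> e0 [_ PZ].
have -> : [set t | forall i, (`|Z t i - y i| < e)%R] =
    [set t | forall i, `](y i - e)%R, (y i + e)%R[%classic (Z t i)].
  by apply/seteqP; split => t /= h i; have := h i; rewrite in_itv/= ltr_distl.
rewrite (PZ (fun i => `](y i - e)%R, (y i + e)%R[%classic))//.
apply: (big_ind (fun x : \bar R => 0 < x)) => // [x y0 x0 yy0|i _].
  exact: mule_gt0.
by apply: normal_prob_itv_gt0; lra.
Qed.

Variable n : nat.
Implicit Types X Y : T -> 'rV[R]_n.

Lemma standard_gaussian_iid X : standard_gaussian P X ->
  iid_normal P (fun t i => X t 0%R i).
Proof.
move=> [mX nX iX]; split => // B mB.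
have -> : [set t | forall i, B i (X t 0%R i)] = \bigcap_i (coords X i @^-1` B i).
  by apply/seteqP; split => t /= h i; [move=> _; exact: h|exact: (h i Logic.I)].
by rewrite iX//; apply: eq_bigr => i _; exact: nX.
Qed.

Lemma g_sigma_preimage_box X (B : 'I_n -> set R) : (forall i, measurable (B i)) ->
  g_sigma_preimage (coords X) [set t | forall i, B i (X t 0%R i)].
Proof.
move=> mB.
pose G : set (set T) := \big[setU/set0]_(i < n) preimage_set_system setT (coords X i) measurable.
have -> : [set t | forall i, B i (X t 0%R i)] = \bigcap_(i in [set: 'I_n]) (coords X i @^-1` B i).
  by apply/seteqP; split => t /= h i; [move=> _; exact: h|exact: (h i Logic.I)].
have := @fin_bigcap_measurable _ (g_sigma_algebraType G) _ [set: 'I_n] (fun i => coords X i @^-1` B i).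
apply => // i _; apply: sub_sigma_algebra; rewrite /G (bigD1 i)//=; left.
by exists (B i) => //; rewrite setTI.
Qed.

Definition join_families X Y : T -> 'I_n + 'I_n -> R := fun t k =>
  match k with inl i => X t 0%R i | inr i => Y t 0%R i end.

Lemma independent_gaussians_iid X Y :
  standard_gaussian P X -> standard_gaussian P Y -> independent_vectors P X Y ->
  iid_normal P (join_families X Y).
Proof.
move=> /standard_gaussian_iid[mX PX] /standard_gaussian_iid[mY PY] XY.
split=> [[i|i]|B mB]; [exact: mX|exact: mY|].
have -> : [set t | forall k, B k (join_families X Y t k)] =
    [set t | forall i, B (inl i) (X t 0%R i)] `&` [set t | forall i, B (inr i) (Y t 0%R i)].
  apply/seteqP; split => t /=; last by move=> [h1 h2] [i|i] /=.
  by move=> h; split => i; [exact: (h (inl i))|exact: (h (inr i))].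
rewrite XY; last 2 first.
- by apply: (g_sigma_preimage_box (B := fun i => B (inl i))) => i.
- by apply: (g_sigma_preimage_box (B := fun i => B (inr i))) => i.
by rewrite big_sumType/= (PX (fun i => B (inl i)))// (PY (fun i => B (inr i))).
Qed.

End families.

(** * Support functions *)

Section dot_product.
Context (R : realType) (n : nat).
Implicit Types (x y v w : 'rV[R]_n) (C : set 'rV[R]_n).

Lemma dotE v x : dot v x = \sum_i v 0 i * x 0 i.
Proof. by rewrite /dot mxE; apply: eq_bigr => i _; rewrite mxE. Qed.

Lemma dotC v x : dot v x = dot x v.
Proof. by rewrite !dotE; apply: eq_bigr => i _; rewrite mulrC. Qed.

Lemma dotDl v w x : dot (v + w) x = dot v x + dot w x.
Proof. by rewrite /dot mulmxDl mxE. Qed.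

Lemma dotZl a v x : dot (a *: v) x = a * dot v x.
Proof. by rewrite /dot -scalemxAl mxE. Qed.

Lemma dotNl v x : dot (- v) x = - dot v x.
Proof. by rewrite -scaleN1r dotZl mulN1r. Qed.

Lemma dotBl v w x : dot (v - w) x = dot v x - dot w x.
Proof. by rewrite dotDl dotNl. Qed.

Lemma dotDr v x y : dot v (x + y) = dot v x + dot v y.
Proof. by rewrite dotC dotDl !(dotC v). Qed.

Lemma dotZr a v x : dot v (a *: x) = a * dot v x.
Proof. by rewrite dotC dotZl dotC. Qed.

Lemma dotBr v x y : dot v (x - y) = dot v x - dot v y.
Proof. by rewrite dotC dotBl !(dotC v). Qed.

Lemma dot_ge0 x : 0 <= dot x x.
Proof. by rewrite dotE; apply: sumr_ge0 => i _; rewrite -expr2 sqr_ge0. Qed.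

Lemma dot_eq0 x : (dot x x == 0) = (x == 0).
Proof.
apply/idP/eqP => [|->]; last by rewrite dotE big1// => i _; rewrite mxE mul0r.
rewrite dotE psumr_eq0; last by move=> i _; rewrite -expr2 sqr_ge0.
move=> /allP h; apply/rowP => i; rewrite mxE; apply/eqP.
by rewrite -sqrf_eq0 expr2; exact: h (mem_index_enum i).
Qed.

Lemma enorm_sqr x : enorm x ^+ 2 = dot x x.
Proof. by rewrite sqr_sqrtr// dot_ge0. Qed.

(** Lipschitz bounds are taken in this norm because its measurability and its expectation reduce at
    once to those of the absolute values of the coordinates. *)
Definition l1 x := \sum_i `|x 0 i|.

Lemma l1_ge0 x : 0 <= l1 x.
Proof. by apply: sumr_ge0. Qed.

Lemma l1D x y : l1 (x + y) <= l1 x + l1 y.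
Proof. by rewrite /l1 -big_split; apply: ler_sum => i _; rewrite mxE ler_normD. Qed.

Lemma l1Z a x : l1 (a *: x) = `|a| * l1 x.
Proof. by rewrite /l1 mulr_sumr; apply: eq_bigr => i _; rewrite mxE normrM. Qed.

Lemma l1N x : l1 (- x) = l1 x.
Proof. by rewrite -scaleN1r l1Z normrN1 mul1r. Qed.

Lemma le_dot_l1 v x M : (forall i, `|x 0 i| <= M) -> `|dot v x| <= M * l1 v.
Proof.
move=> xM; rewrite dotE (le_trans (ler_norm_sum _ _ _))// mulr_sumr.
by apply: ler_sum => i _; rewrite normrM mulrC ler_wpM2r.
Qed.

Lemma coord_le_enorm x i : `|x 0 i| <= enorm x.
Proof.
rewrite -ler_sqr ?nnegrE ?sqrtr_ge0// enorm_sqr real_normK ?num_real// dotE (bigD1 i)//=.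
by rewrite expr2 lerDl; apply: sumr_ge0 => j _; rewrite -expr2 sqr_ge0.
Qed.

Lemma l1_le_enorm x : l1 x <= n%:R * enorm x.
Proof.
rewrite mulr_natl -[X in _ *+ X]card_ord -sumr_const.
by apply: ler_sum => i _; exact: coord_le_enorm.
Qed.

Lemma dot_continuous v : continuous (dot v).
Proof.
have -> : dot v = fun x => \sum_i v 0 i * x 0 i by apply/funext => x; exact: dotE.
apply: continuous_big => [|i _ x]; first exact: add_continuous.
  apply: (@continuousM R _ (cst (v 0 i)) (fun x : 'rV[R]_n => x 0 i));
    [exact: cst_continuous|exact: coord_continuous].
Qed.

End dot_product.

(** * Positively homogeneous Lipschitz functions *)

Section hom_lip.
Context (R : realType) (n : nat).

(** Test functions for comparing laws: the Lipschitz bound gives measurability and controls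
    integrability, while positive homogeneity extracts the length of a combination. Support
    functions have both properties. *)
Definition lip (f : 'rV[R]_n -> R) := exists2 L, 0 <= L &
  forall x y, `|f x - f y| <= L * l1 (x - y).

Definition poshom (f : 'rV[R]_n -> R) := forall a x, 0 <= a -> f (a *: x) = a * f x.

Lemma poshom0 f : poshom f -> f 0 = 0.
Proof. by move=> /(_ 0 0 (lexx _)); rewrite scale0r mul0r. Qed.

Lemma lip_comp_opp f : lip f -> lip (fun x => f (- x)).
Proof.
move=> [L L0 fL]; exists L => // x y; apply: le_trans (fL _ _) _.
by rewrite -opprD l1N.
Qed.

Lemma poshom_comp_opp f : poshom f -> poshom (fun x => f (- x)).
Proof. by move=> fh a x a0; rewrite -scalerN fh. Qed.

Lemma dense_rat_rV (x : 'rV[R]_n) e : 0 < e ->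
  exists q : 'rV[rat]_n, l1 (x - map_mx ratr q) < e.
Proof.
(* With n + 1 in place of n the final inequality is strict, and n = 0 needs no separate case. *)
move=> e0; pose e' := e / n.+1%:R.
have e'0 : 0 < e' by rewrite divr_gt0.
have /choice[q qP] : forall i : 'I_n, exists q : rat, `|x 0 i - ratr q| <= e'.
  move=> i; have [|q] := @rat_in_itvoo R (x 0 i - e') (x 0 i + e'); first by lra.
  by rewrite in_itv/= => h; exists q; rewrite distrC ler_norml; lra.
exists (\row_i q i).
apply: (@le_lt_trans _ _ (\sum_(i < n) e')).
  by apply: ler_sum => i _; rewrite !mxE; exact: qP.
rewrite sumr_const card_ord -mulr_natr /e' mulrAC ltr_pdivrMr//.
by rewrite ltr_pM2l// ltr_nat.
Qed.

(* For f L-Lipschitz, f x = inf_q (f q + L |x - q|) over the countable dense set of rational q. *)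
Lemma lip_measurable d (T : measurableType d) (X : T -> 'rV[R]_n) f :
  (forall i, measurable_fun setT (fun t => X t 0 i)) -> lip f ->
  measurable_fun setT (fun t => f (X t)).
Proof.
move=> mX [L L0 fL].
apply: (measurability _ (RGenInftyO.measurableE R)) => //.
move=> /= _ [_ [a ->] <-]; rewrite setTI.
pose g (q : 'rV[rat]_n) t := f (map_mx ratr q) + L * l1 (X t - map_mx ratr q).
have -> : (fun t => f (X t)) @^-1` `]-oo, a[%classic = \bigcup_q [set t | g q t < a].
  apply/seteqP; split => t /=; rewrite in_itv/=.
    (* The infimum overshoots f by at most 2 L |X - q|, which this radius keeps below a - f; the
       added 1 covers L = 0. *)
    move=> fa; have [|q qP] := @dense_rat_rV (X t) ((a - f (X t)) / (2 * L + 1)).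
      by rewrite divr_gt0 ?subr_gt0//; lra.
    exists q => //=; rewrite /g.
    move: qP; rewrite ltr_pdivlMr; last by lra.
    have := fL (map_mx ratr q) (X t); rewrite -l1N opprB ler_norml => /andP[_].
    by have := l1_ge0 (X t - map_mx ratr q); nra.
  move=> [q _] /=; rewrite /g; apply: le_lt_trans.
  by have := fL (X t) (map_mx ratr q); rewrite ler_norml => /andP[_]; lra.
apply: countable_bigcupT_measurable => [|q]; first exact: countableP.
rewrite (_ : [set t | _] = setT `&` g q @^-1` `]-oo, a[%classic); last first.
  by rewrite setTI; apply/seteqP; split => t; rewrite /= in_itv.
have mg : measurable_fun setT (g q).
  apply: measurable_funD => //; apply: measurable_funM => //.
  apply: measurable_sum => i; apply: measurableT_comp => //.
  under eq_fun do rewrite !mxE.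
  exact: measurable_funB.
exact: mg.
Qed.

End hom_lip.

Section support_function.
Context (R : realType) (n : nat) (C : set 'rV[R]_n).
Hypotheses (C_compact : compact C) (C_nonempty : C !=set0).
Implicit Types x v w : 'rV[R]_n.

Lemma compact_coord_bounded : exists2 M, 0 <= M & forall x, C x -> forall i, `|x 0 i| <= M.
Proof.
have /choice[M CM] : forall i, exists M, forall x, C x -> `|x 0 i| <= M.
  move=> i; have ci : continuous (fun x : 'rV[R]_n => `|x 0 i|).
    move=> x; apply: (@continuous_comp _ _ _ (fun x : 'rV[R]_n => x 0 i) (@Num.norm _ R));
      [exact: coord_continuous|exact: norm_continuous].
  have [c Cc cmax] := compact_EVT_max C_nonempty C_compact (continuous_subspaceT ci).
  by exists `|c 0 i| => x Cx; apply: cmax; rewrite inE.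
exists (\sum_i `|M i|) => [|x Cx i]; first exact: sumr_ge0.
rewrite (bigD1 i)//= (le_trans (CM i x Cx))// (le_trans (ler_norm _))// lerDl.
exact: sumr_ge0.
Qed.

Lemma maxC_attained v : exists2 x, C x & dot v x = maxC C v /\ forall y, C y -> dot v y <= dot v x.
Proof.
have [c Cc cmax] := compact_EVT_max C_nonempty C_compact
  (continuous_subspaceT (@dot_continuous R n v)).
move: Cc; rewrite inE => Cc; have cm y : C y -> dot v y <= dot v c.
  by move=> Cy; apply: cmax; rewrite inE.
exists c => //; split=> //; apply/eqP; rewrite eq_le; apply/andP; split.
  apply: ub_le_sup; last by exists c.
  by exists (dot v c) => _ [y Cy <-]; exact: cm.
apply: ge_sup; first by exists (dot v c), c.
by move=> _ [y Cy <-]; exact: cm.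
Qed.

Lemma dot_le_maxC v x : C x -> dot v x <= maxC C v.
Proof. by move=> Cx; have [c Cc [<- cmax]] := maxC_attained v; exact: cmax. Qed.

Lemma minC_eq v : minC C v = - maxC C (- v).
Proof.
rewrite /minC /maxC /inf; congr (- sup _); apply/seteqP; split => r /=.
  by move=> [_ [x Cx <-] <-]; exists x => //; rewrite dotNl.
by move=> [x Cx <-]; exists (dot v x); [exists x|rewrite dotNl].
Qed.

Lemma rangeC_eq v : rangeC C v = maxC C v + maxC C (- v).
Proof. by rewrite /rangeC minC_eq opprK. Qed.

Lemma lip_maxC : lip (maxC C).
Proof.
have [M M0 CM] := compact_coord_bounded; exists M => // x y.
have key v w : maxC C v - maxC C w <= M * l1 (v - w).
  have [c Cc [<- _]] := maxC_attained v.
  rewrite (le_trans (lerB (lexx _) (dot_le_maxC w Cc)))// -dotBl.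
  exact: le_trans (ler_norm _) (le_dot_l1 _ (CM _ Cc)).
by rewrite ler_norml key andbT lerNl opprB -[l1 _]l1N opprB key.
Qed.

Lemma poshom_maxC : poshom (maxC C).
Proof.
move=> a x a0; have [c Cc [<- cmax]] := maxC_attained x.
have [e Ce [<- emax]] := maxC_attained (a *: x).
apply/eqP; rewrite eq_le; apply/andP; split; last by rewrite -dotZl; exact: emax.
by rewrite dotZl ler_wpM2l// cmax.
Qed.

Lemma face_attained v w : exists2 x, C x /\ dot v x = maxC C v &
  dot w x = inf [set dot w x | x in C `&` [set x | dot v x = maxC C v]].
Proof.
have Fcompact : compact (C `&` [set x | dot v x = maxC C v]).
  apply: compact_closedI => //.
  have -> : [set x | dot v x = maxC C v] = dot v @^-1` [set y | y = maxC C v] by [].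
  by apply: closed_comp => [x _|]; [exact: dot_continuous|exact: closed_eq].
have F0 : C `&` [set x | dot v x = maxC C v] !=set0.
  by have [c Cc [e _]] := maxC_attained v; exists c.
have [c Fc cmin] := compact_EVT_min F0 Fcompact
  (continuous_subspaceT (@dot_continuous R n w)).
move: Fc; rewrite inE => Fc; exists c; first exact: Fc.
apply/eqP; rewrite eq_le; apply/andP; split.
  apply: lb_le_inf; first by exists (dot w c), c.
  by move=> _ [y Fy <-]; apply: cmin; rewrite inE.
apply: ge_inf; last by exists c.
by exists (dot w c) => _ [y Fy <-]; apply: cmin; rewrite inE.
Qed.

Lemma face_le v w x : C x -> dot v x = maxC C v ->
  inf [set dot w x | x in C `&` [set x | dot v x = maxC C v]] <= dot w x.
Proof.
move=> Cx vx; have [M _ CM] := compact_coord_bounded.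
apply: ge_inf; last by exists x.
exists (- (M * l1 w)) => _ [y [Cy _] <-].
by have := le_dot_l1 w (CM _ Cy); rewrite ler_norml => /andP[].
Qed.

(* Danskin: the one-sided derivative of the support function at v is the support function of
   the face exposed by v. *)
Lemma danskin v w e : 0 < e -> exists2 h0, 0 < h0 & forall h, 0 < h -> h < h0 ->
  `|maxC C w + (maxC C (v - h *: w) - maxC C v) / h - loss C v w| <= e.
Proof.
move=> e0; rewrite /loss; set m := inf _.
have [c [Cc cv] cm] := face_attained v w; rewrite -/m in cm.
have [M M0 CM] := compact_coord_bounded.
have wB x : C x -> `|dot w x| <= M * l1 w by move=> /CM; exact: le_dot_l1.
(* The point [c] of the exposed face that minimizes w remains a competitor for every direction v - h
   w. *)
have lower h : 0 < h -> - m <= (maxC C (v - h *: w) - maxC C v) / h.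
  move=> h0; rewrite ler_pdivlMr// lerBrDr.
  have := dot_le_maxC (v - h *: w) Cc; rewrite dotBl dotZl cv cm; lra.
suff [h0 h00 upper] : exists2 h0, 0 < h0 & forall h, 0 < h -> h < h0 ->
    forall x, C x -> dot v x - h * dot w x <= maxC C v - h * (m - e).
  exists h0 => // h hp hh0.
  have [x Cx [xE _]] := maxC_attained (v - h *: w).
  have := upper h hp hh0 x Cx; have := lower h hp; rewrite -xE dotBl dotZl => lo up.
  have : (dot v x - h * dot w x - maxC C v) / h <= - m + e.
    by rewrite ler_pdivrMr//; lra.
  by rewrite ler_norml; lra.
(* Points of C with w . x > m - e satisfy the upper bound for every h > 0. The others form a compact
   set that misses the face exposed by v, so there v . x stays below its maximum by a fixed gap. *)
have K_compact : compact (C `&` [set x | dot w x <= m - e]).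
  apply: compact_closedI => //.
  have -> : [set x | dot w x <= m - e] = dot w @^-1` [set y | y <= m - e] by [].
  by apply: closed_comp => [x _|]; [exact: dot_continuous|exact: closed_le].
have [K0|/set0P K0] := eqVneq (C `&` [set x | dot w x <= m - e]) set0.
  exists 1 => // h hp _ x Cx; have vx := dot_le_maxC v Cx.
  suff : m - e < dot w x by nra.
  by rewrite ltNge; apply/negP => wx; have : set0 x by rewrite -K0.
have [k] := compact_EVT_max K0 K_compact (continuous_subspaceT (@dot_continuous R n v)).
rewrite inE => -[Ck /= wk] kmax.
have delta : dot v k < maxC C v.
  rewrite lt_neqAle dot_le_maxC// andbT; apply/eqP => vk.
  by have := face_le w Ck vk; rewrite -/m; lra.
have B0 : 0 <= M * l1 w by rewrite mulr_ge0// l1_ge0.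
(* On that set m - e - w . x is at most twice [M * l1 w], so for such h the gain from w cannot
   exceed the gap. The added 1 keeps the denominator positive. *)
exists ((maxC C v - dot v k) / (2 * (M * l1 w) + 1)).
  by rewrite divr_gt0 ?subr_gt0//; lra.
move=> h hp; rewrite ltr_pdivlMr; last by lra.
move=> hh x Cx; have vx := dot_le_maxC v Cx.
have [wx|wx] := lerP (dot w x) (m - e); last by nra.
have := kmax x; rewrite inE => /(_ (conj Cx wx)) vxk.
have := wB _ Cx; have := wB _ Cc; rewrite !ler_norml cm => /andP[_ mB] /andP[xB _].
nra.
Qed.

Lemma cvg_loss v w :
  (fun k : nat => maxC C w + k.+1%:R * (maxC C (v - k.+1%:R^-1 *: w) - maxC C v)) @ \oo --> loss C v w.
Proof.
apply/cvgrPdist_le => e e0; have [h0 h00 dan] := danskin v w e0.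
near=> k; have := dan k.+1%:R^-1; rewrite invrK [_ * k.+1%:R]mulrC distrC; apply.
  by rewrite invr_gt0.
near: k; exact: near_infty_natSinv_lt (PosNum h00).
Unshelve. all: by end_near. Qed.

(** The two arguments differ by w / (k + 1), so the factor k + 1 cancels and the bound is uniform in
    k, as dominated convergence requires. *)
Lemma norm_quotient_le (L : R) v w k :
  (forall x y, `|maxC C x - maxC C y| <= L * l1 (x - y)) ->
  `|k.+1%:R * (maxC C (v - k.+1%:R^-1 *: w) - maxC C v)| <= L * l1 w.
Proof.
move=> CL; rewrite normrM ger0_norm//; apply: (le_trans (ler_wpM2l _ (CL _ _))) => //.
rewrite addrAC subrr add0r l1N l1Z ger0_norm ?invr_ge0// mulrCA mulrA mulrA.
by rewrite mulrK// ?unitfE// mulrC mulrA; lra.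
Qed.

End support_function.

(** * Expected loss *)

(** This is the derivative at h = 0 of the length [q h] of (c - h, s). Multiplication by the
    conjugate [q h + 1] turns the quotient into (h - 2c) / (q h + 1). *)
Lemma cvg_sqrt_quotient (R : realType) (c s : R) : c ^+ 2 + s ^+ 2 = 1 ->
  (fun k => k.+1%:R * (Num.sqrt ((c - k.+1%:R^-1) ^+ 2 + s ^+ 2) - 1)) @ \oo --> - c.
Proof.
move=> cs.
pose q (h : R) := Num.sqrt ((c - h) ^+ 2 + s ^+ 2).
have -> : (fun k => k.+1%:R * (Num.sqrt ((c - k.+1%:R^-1) ^+ 2 + s ^+ 2) - 1)) =
    (fun k => (@harmonic R k - 2 * c) * (q (@harmonic R k) + 1)^-1).
  apply/funext => k; rewrite -/(q _) /harmonic; set h := k.+1%:R^-1.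
  have q0 : 0 <= q h by exact: sqrtr_ge0.
  have q1 : q h + 1 != 0 by rewrite gt_eqF//; lra.
  have qq : q h ^+ 2 = (c - h) ^+ 2 + s ^+ 2 by rewrite sqr_sqrtr// addr_ge0 ?sqr_ge0.
  apply: (mulIf q1); rewrite divfK//.
  have -> : k.+1%:R * (q h - 1) * (q h + 1) = k.+1%:R * (q h ^+ 2 - 1) by ring.
  rewrite qq -[in X in _ - X]cs.
  transitivity (k.+1%:R * h * (h - 2 * c)); first by ring.
  by rewrite /h mulfV ?mul1r// pnatr_eq0.
have h0 : @harmonic R @ \oo --> (0 : R) by exact: cvg_harmonic.
have q0 : (fun k => q (@harmonic R k)) @ \oo --> (1 : R).
  have -> : (1 : R) = Num.sqrt ((c - 0) ^+ 2 + s ^+ 2) by rewrite subr0 cs sqrtr1.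
  apply: (@continuous_cvg _ _ _ _ _ (fun k => (c - @harmonic R k) ^+ 2 + s ^+ 2)).
    exact: sqrt_continuous.
  apply: cvgD; last exact: cvg_cst.
  by under eq_fun do rewrite expr2; rewrite expr2; apply: cvgM; apply: cvgB => //; exact: cvg_cst.
have -> : - c = (0 - 2 * c) * (1 + 1)^-1 by rewrite (_ : 1 + 1 = 2)//; lra.
apply: cvgM; first by apply: cvgB => //; exact: cvg_cst.
apply: cvgV; first by rewrite gt_eqF//; lra.
by apply: cvgD => //; exact: cvg_cst.
Qed.

Section expected_loss.
Context (R : realType) (n : nat) d (T : measurableType d) (P : probability T R).
Variables (w u : T -> 'rV[R]_n).
Hypotheses (mw : forall i, measurable_fun setT (fun t => w t 0 i))
           (mu : forall i, measurable_fun setT (fun t => u t 0 i)).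
Hypotheses (iw : P.-integrable setT (fun t => (l1 (w t))%:E))
           (iu : P.-integrable setT (fun t => (l1 (u t))%:E)).
(** All that is assumed of the law of (w, u) beyond measurability and integrability. The condition
    on b makes a^2 + b^2 positive, so that the combination can be normalized; in the application b
    is sin alpha or 1 or -1. *)
Hypothesis isotropic : forall f, lip f -> poshom f -> forall a b : R, b != 0 ->
  (\int[P]_t (f (a *: w t + b *: u t))%:E =
   (Num.sqrt (a ^+ 2 + b ^+ 2))%:E * \int[P]_t (f (w t))%:E)%E.

Let mcomb a b i : measurable_fun setT (fun t => (a *: w t + b *: u t) 0 i).
Proof.
under eq_fun do rewrite !mxE.
by apply: measurable_funD; exact: measurable_funM.
Qed.

Lemma integrable_lip_comb f a b : lip f -> poshom f ->
  P.-integrable setT (fun t => (f (a *: w t + b *: u t))%:E).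
Proof.
move=> fl fh; have mf := lip_measurable (mcomb a b) fl.
have [L L0 fL] := fl.
have : P.-integrable setT (fun t => (L%:E * (`|a|%:E * (l1 (w t))%:E + `|b|%:E * (l1 (u t))%:E))%E).
  by apply: integrableZl => //; apply: integrableD => //; exact: integrableZl.
apply: le_integrable => //; first exact/measurable_EFinP.
move=> t _; rewrite /= lee_fin.
rewrite (le_trans _ (ler_norm _))//.
have := fL (a *: w t + b *: u t) 0; rewrite (poshom0 fh) !subr0 => /le_trans; apply.
by rewrite ler_wpM2l// (le_trans (l1D _ _))// !l1Z.
Qed.

Lemma integrable_lip f : lip f -> poshom f -> P.-integrable setT (fun t => (f (w t))%:E).
Proof.
move=> fl fh; apply: eq_integrable (integrable_lip_comb 1 0 fl fh) => // t _.
by rewrite scale1r scale0r addr0.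
Qed.

(** As a combination, -w has b = 0, so [isotropic] does not apply to it directly. Both sides are
    compared with the integral of f(u), using b = 1 for f and b = -1 for its reflection. *)
Lemma integral_symmetric f : lip f -> poshom f ->
  (\int[P]_t (f (- w t))%:E = \int[P]_t (f (w t))%:E)%E.
Proof.
move=> fl fh.
have := isotropic (lip_comp_opp fl) (poshom_comp_opp fh) 0 (b := -1).
have := isotropic fl fh 0 (b := 1).
rewrite oppr_eq0 oner_eq0 expr0n/= !add0r sqrrN !expr1n !sqrtr1 !mul1e => /(_ isT) <- /(_ isT) <-.
by apply: eq_integral => t _; rewrite !scale0r !add0r scaleN1r opprK scale1r.
Qed.

Variables (alpha : R) (C : set 'rV[R]_n).
Hypotheses (C_compact : compact C) (C_nonempty : C !=set0) (sin_neq0 : sin alpha != 0).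
Let v t := cos alpha *: w t + sin alpha *: u t.

Let hl := lip_maxC C_compact C_nonempty.
Let hh := poshom_maxC C_compact C_nonempty.

Lemma integrable_rangeC : P.-integrable setT (fun t => (rangeC C (w t))%:E).
Proof.
under eq_fun do rewrite rangeC_eq EFinD.
apply: integrableD => //; first exact: integrable_lip.
exact: integrable_lip (lip_comp_opp hl) (poshom_comp_opp hh).
Qed.

Lemma integral_rangeC :
  (\int[P]_t (rangeC C (w t))%:E = 2%:E * \int[P]_t (maxC C (w t))%:E)%E.
Proof.
under eq_integral do rewrite rangeC_eq EFinD.
rewrite integralD//; last 2 first.
- exact: integrable_lip.
- exact: integrable_lip (lip_comp_opp hl) (poshom_comp_opp hh).
rewrite integral_symmetric//.
have := integrable_fin_num measurableT (integrable_lip hl hh).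
by move=> /fineK <-; rewrite -EFinD -EFinM; congr (_%:E); ring.
Qed.

Lemma expected_loss :
  P.-integrable setT (fun t => (loss C (v t) (w t))%:E) /\
  (\int[P]_t (loss C (v t) (w t))%:E =
   ((1 - cos alpha) / 2)%:E * \int[P]_t (rangeC C (w t))%:E)%E.
Proof.
pose g k t := maxC C (w t) + k.+1%:R * (maxC C (v t - k.+1%:R^-1 *: w t) - maxC C (v t)).
have vw k t : v t - k.+1%:R^-1 *: w t =
    (cos alpha - k.+1%:R^-1) *: w t + sin alpha *: u t.
  by rewrite /v addrAC scalerBl.
have gi k : P.-integrable setT (fun t => (g k t)%:E).
  rewrite /g; under eq_fun do rewrite EFinD EFinM EFinB vw.
  apply: integrableD => //; first exact: integrable_lip.
  by apply: integrableZl => //; apply: integrableB => //; exact: integrable_lip_comb.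
have [L L0 CL] := hl.
have mg k := measurable_int P (gi k).
have gl t : (fun k => g k t) @ \oo --> loss C (v t) (w t) by exact: cvg_loss.
have ml : measurable_fun setT (fun t => (loss C (v t) (w t))%:E).
  apply/measurable_EFinP; apply: (measurable_fun_cvg (h := g)) => [k|t _].
    by apply/measurable_EFinP; exact: mg.
  exact: gl.
(* The dominating function is 2 L |w|: one L |w| for the support function at w, one for the
   quotient. *)
have [] := @dominated_convergence _ T R P setT measurableT (fun k t => (g k t)%:E)
  (fun t => (loss C (v t) (w t))%:E) (fun t => ((2 * L) * l1 (w t))%:E) mg ml.
- apply: aeW => t _; apply: cvg_EFin; first by near=> k.
  exact: gl.
- by under eq_fun do rewrite EFinM; exact: integrableZl.
- apply: aeW => t k _; rewrite /= lee_fin /g.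
  apply: le_trans (ler_normD _ _) _.
  have := CL (w t) 0; rewrite (poshom0 hh) !subr0.
  have := norm_quotient_le (v t) (w t) k CL; lra.
move=> li _ lcvg; split => //.
have S_fin := integrable_fin_num measurableT (integrable_lip hl hh).
set S := (\int[P]_t (maxC C (w t))%:E)%E in S_fin.
have gE k : (\int[P]_t (g k t)%:E = (fine S + k.+1%:R *
    (Num.sqrt ((cos alpha - k.+1%:R^-1) ^+ 2 + sin alpha ^+ 2) - 1) * fine S)%:E)%E.
  rewrite /g; under eq_integral do rewrite EFinD EFinM EFinB vw.
  rewrite integralD//; last 2 first.
  - exact: integrable_lip.
  - by apply: integrableZl => //; apply: integrableB => //; exact: integrable_lip_comb.
  rewrite integralZl//; last by apply: integrableB => //; exact: integrable_lip_comb.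
  rewrite integralB//; last 2 first.
  - exact: integrable_lip_comb.
  - exact: integrable_lip_comb.
  rewrite !(isotropic hl hh _ sin_neq0) cos2Dsin2 sqrtr1 mul1e -/S -(fineK S_fin) /=.
  by rewrite -EFinM -EFinD; congr (_%:E); ring.
(* The limit is (1 - cos alpha) S, and the expected range is 2 S; this is the origin of the factor
   1/2. *)
have gcvg : ((\int[P]_t (g k t)%:E)%E @[k --> \oo] --> (fine S + - cos alpha * fine S)%:E)%E.
  under eq_fun do rewrite gE.
  apply: cvg_EFin; first by near=> k.
  apply: cvgD; first exact: cvg_cst.
  apply: cvgM; last exact: cvg_cst.
  by apply: cvg_sqrt_quotient; exact: cos2Dsin2.
have -> := cvg_unique (@ereal_hausdorff R) lcvg gcvg.
rewrite integral_rangeC -/S -(fineK S_fin) -!EFinM; congr (_%:E) => /=; lra.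
Unshelve. all: by end_near. Qed.

End expected_loss.

(** * Distribution 1 *)

(** The integrand is dominated by a multiple of the normal density of standard deviation 2. The
    exponents differ by 3 x^2 / 8, and |x| <= 1 + 3 x^2 / 8 <= exp(3 x^2 / 8). *)
Lemma normal_prob_abs_lty (R : realType) :
  (\int[normal_prob 0 1]_x `|x : measurableTypeR R|%:E < +oo)%E.
Proof.
rewrite ge0_integral_normal_prob//=; last first.
  by apply/measurable_EFinP; exact: normr_measurable.
pose K : R := normal_peak 1 / normal_peak 2.
have p1 : 0 < normal_peak 1 :> R by rewrite normal_peak_gt0// oner_neq0.
have p2 : 0 < normal_peak 2 :> R by rewrite normal_peak_gt0// pnatr_eq0.
apply: (@le_lt_trans _ _ (\int[lebesgue_measure]_x (K%:E * (normal_pdf 0 2 x)%:E))%E); last first.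
  by rewrite integralZl//= ?integral_normal_pdf ?mule1 ?ltry//; exact: integrable_normal_pdf.
apply: ge0_le_integral => //.
- by move=> x _; rewrite mule_ge0// lee_fin// normal_pdf_ge0.
- apply: emeasurable_funM; apply/measurable_EFinP; first exact: normr_measurable.
  exact: measurable_normal_pdf.
- by apply: emeasurable_funM => //; apply/measurable_EFinP; exact: measurable_normal_pdf.
move=> x _; rewrite -!EFinM lee_fin !normal_pdfE ?oner_neq0 ?pnatr_eq0//.
rewrite [leRHS]mulrA (_ : K * _ = normal_peak 1) ?divfK ?gt_eqF// mulrCA ler_wpM2l ?(ltW p1)//.
rewrite /normal_fun subr0 expr1n.
have -> : - x ^+ 2 / (2 ^+ 2 *+ 2) = - x ^+ 2 / (1 *+ 2) + 3 / 8 * x ^+ 2 by field.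
rewrite expRD mulrC ler_wpM2l ?expR_ge0//.
apply: le_trans (expR_ge1Dx _).
rewrite -[x ^+ 2]real_normK ?num_real//; have := sqr_ge0 (1 - `|x| / 2); have := sqr_ge0 `|x|; nra.
Qed.

Section gaussian_vectors.
Context (R : realType) d (T : measurableType d) (P : probability T R).

Lemma iid_normal_marginal (I : finType) (Z : T -> I -> R) i (B : set R) : iid_normal P Z ->
  measurable B -> P [set t | B (Z t i)] = normal_prob 0 1 B.
Proof.
move=> [mZ PZ] mB; pose B' k := if k == i then B else setT.
have -> : [set t | B (Z t i)] = [set t | forall k, B' k (Z t k)].
  apply/seteqP; split => t /=; first by move=> Bt k; rewrite /B'; case: eqP => // ->.
  by move=> /(_ i); rewrite /B' eqxx.
rewrite PZ; last by move=> k; rewrite /B'; case: ifP.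
rewrite (bigD1 i)//= /B' eqxx big1 ?mule1// => k /negbTE ->.
by rewrite probability_setT.
Qed.

Lemma iid_normal_abs_integrable (I : finType) (Z : T -> I -> R) i : iid_normal P Z ->
  P.-integrable setT (fun t => `|Z t i|%:E).
Proof.
move=> iZ; have mZi := iZ.1 i; apply/integrableP; split.
  by apply/measurable_EFinP; exact: measurableT_comp.
under eq_integral do rewrite /= normr_id.
apply: le_lt_trans (@normal_prob_abs_lty R); rewrite le_eqVlt; apply/orP; left; apply/eqP.
have mf : measurable_fun [set: measurableTypeR R] (fun x : measurableTypeR R => `|x|%:E).
  by apply/measurable_EFinP; exact: normr_measurable.
have := @ge0_integral_pushforward _ _ _ (measurableTypeR R) R (fun t => Z t i) mZi P setT _
  measurableT mf.
rewrite preimage_setT /= => <-//.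
by apply: eq_measure_integral => B mB _; exact: iid_normal_marginal.
Qed.

Variable n : nat.
Implicit Types (X : T -> 'rV[R]_n) (f : 'rV[R]_n -> R).

Lemma iid_normal_l1_integrable X : iid_normal P (fun t i => X t 0 i) ->
  P.-integrable setT (fun t => (l1 (X t))%:E).
Proof.
move=> iX; rewrite /l1; under eq_fun do rewrite -sumEFin.
by apply: integrable_sum => // i _; exact: (iid_normal_abs_integrable i iX).
Qed.

Lemma iid_normal_lip_integrable X f : iid_normal P (fun t i => X t 0 i) ->
  lip f -> poshom f -> P.-integrable setT (fun t => (f (X t))%:E).
Proof.
move=> iX fl fh; have mf := lip_measurable iX.1 fl; have [L L0 fL] := fl.
have : P.-integrable setT (fun t => (L%:E * (l1 (X t))%:E)%E).
  by apply: integrableZl => //; exact: iid_normal_l1_integrable.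
apply: le_integrable => //; first exact/measurable_EFinP.
move=> t _; rewrite /= lee_fin; have := fL (X t) 0.
by rewrite (poshom0 fh) !subr0 => /le_trans; apply; exact: ler_norm.
Qed.

Lemma iid_normal_rots (Z : T -> 'I_n + 'I_n -> R) c s (r : seq 'I_n) :
  c ^+ 2 + s ^+ 2 = 1 -> iid_normal P Z ->
  iid_normal P (fun t => foldr (fun i => givens (inl i) (inr i) c s) (Z t) r).
Proof.
by move=> cs iZ; elim: r => //= i r IH; exact: (iid_normal_givens _ cs IH).
Qed.

(** The rotations act on disjoint pairs (w_i, u_i), so the left half becomes c w + s u. The second
    conjunct serves the induction: a pair not yet visited is intact. *)
Lemma foldr_givens (z : 'I_n + 'I_n -> R) c s (r : seq 'I_n) i : uniq r ->
  let z' := foldr (fun i => givens (inl i) (inr i) c s) z r in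
  z' (inl i) = (if i \in r then c * z (inl i) + s * z (inr i) else z (inl i)) /\
  (i \notin r -> z' (inr i) = z (inr i)).
Proof.
elim: r => //= j r IH /andP[jr /IH[IHl IHr]]; rewrite in_cons negb_or.
have inlE (k l : 'I_n) : (inl k == inl l :> 'I_n + 'I_n) = (k == l) by [].
have inrE (k l : 'I_n) : (inr k == inr l :> 'I_n + 'I_n) = (k == l) by [].
have inlrE (k l : 'I_n) : (inl k == inr l :> 'I_n + 'I_n) = false by [].
have inrlE (k l : 'I_n) : (inr k == inl l :> 'I_n + 'I_n) = false by [].
rewrite {1 3}/givens inlE inrE inlrE inrlE; have [ij|ij] := eqVneq i j; last by split.
by rewrite -ij in jr *; rewrite IHl (negbTE jr) IHr.
Qed.

(** After division by s, the combination is the left half of the pair rotated in every plane (w_i,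
    u_i), so it has the law of w; homogeneity restores the factor s. *)
Lemma iid_normal_comb_isotropic (w u : T -> 'rV[R]_n) f a b :
  iid_normal P (join_families w u) -> lip f -> poshom f -> b != 0 ->
  (\int[P]_t (f (a *: w t + b *: u t))%:E =
   (Num.sqrt (a ^+ 2 + b ^+ 2))%:E * \int[P]_t (f (w t))%:E)%E.
Proof.
move=> iZ fl fh b0; set s := Num.sqrt _.
have ab0 : 0 < a ^+ 2 + b ^+ 2 by rewrite ltr_wpDl ?sqr_ge0// lt_def sqrf_eq0 b0 sqr_ge0.
have s0 : 0 < s by rewrite sqrtr_gt0.
have ss : s ^+ 2 = a ^+ 2 + b ^+ 2 by rewrite sqr_sqrtr// ltW.
have cs : (a / s) ^+ 2 + (b / s) ^+ 2 = 1.
  by rewrite !expr_div_n -mulrDl -ss divff// sqrf_eq0 gt_eqF.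
pose X t := (a / s) *: w t + (b / s) *: u t.
have iX : iid_normal P (fun t i => X t 0 i).
  have := iid_normal_inl (iid_normal_rots (enum 'I_n) cs iZ).
  congr iid_normal; apply/funext => t; apply/funext => i.
  have [-> _] := foldr_givens (join_families w u t) (a / s) (b / s) i (enum_uniq 'I_n).
  by rewrite mem_enum /X !mxE.
have iw : iid_normal P (fun t i => w t 0 i) := iid_normal_inl iZ.
transitivity (\int[P]_t (s%:E * (f (X t))%:E))%E.
  apply: eq_integral => t _; rewrite -EFinM -fh ?ltW// /X scalerDr !scalerA.
  by rewrite ![s * _]mulrC !divfK// gt_eqF.
rewrite integralZl//; last exact: iid_normal_lip_integrable.
congr (_ * _)%E.
have mF : measurable_fun setT (fun z : funspace R 'I_n => (f (\row_i z i))%:E).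
  apply/measurable_EFinP; apply: lip_measurable => // i.
  have -> : (fun z : funspace R 'I_n => (\row_j z j) 0 i) = (fun z => z i).
    by apply/funext => z; rewrite mxE.
  exact: measurable_funspace_coord.
have rowE (Y : T -> 'rV[R]_n) :
    (\int[P]_t (f (\row_i Y t 0 i))%:E = \int[P]_t (f (Y t))%:E)%E.
  by apply: eq_integral => t _; congr (f _)%:E; apply/rowP => i; rewrite mxE.
by rewrite -[LHS]rowE -[RHS]rowE; exact: (iid_normal_integral iX iw mF).
Qed.

End gaussian_vectors.

(** * Distribution 2 *)

(** For unit vectors with inner product r, it is positive exactly on the spherical cap r > 1 - e,
    that is, at squared distance below 2e. *)
Definition cap_kernel (R : realType) (e r : R) : R := Num.max 0 (r - (1 - e)).

Lemma cap_kernel_ge0 (R : realType) (e r : R) : 0 <= cap_kernel e r.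
Proof. by rewrite /cap_kernel le_max lexx. Qed.

Lemma measurable_cap_kernel (R : realType) d (T : measurableType d) (e : R) (g : T -> R) :
  measurable_fun setT g -> measurable_fun setT (fun t => (cap_kernel e (g t))%:E).
Proof.
by move=> mg; apply/measurable_EFinP; apply: measurable_maxr => //; exact: measurable_funB.
Qed.

Lemma measurable_dot (R : realType) (n : nat) d (T : measurableType d) (X Y : T -> 'rV[R]_n) :
  (forall i, measurable_fun setT (fun t => X t 0 i)) ->
  (forall i, measurable_fun setT (fun t => Y t 0 i)) ->
  measurable_fun setT (fun t => dot (X t) (Y t)).
Proof.
move=> mX mY; under eq_fun do rewrite dotE.
by apply: measurable_sum => i; exact: measurable_funM.
Qed.

(** * Comparison of isotropic laws on the sphere *)

Section kernel.
Context (R : realType) (n : nat) d (T : measurableType d) (P : probability T R).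
Implicit Types X Y : T -> 'rV[R]_n.

(** Only the kernel averages are required to depend on y through its length, not the whole law to be
    rotation invariant: these averages are what the Fubini argument evaluates. *)
Definition isotropic_law X := forall e y y', dot y y = dot y' y' ->
  (\int[P]_t (cap_kernel e (dot (X t) y))%:E = \int[P]_t (cap_kernel e (dot (X t) y'))%:E)%E.

Definition unit_law X :=
  [/\ forall i, measurable_fun setT (fun t => X t 0 i),
      forall t, dot (X t) (X t) = 1 & isotropic_law X].

Let mK X Y e : (forall i, measurable_fun setT (fun t => X t 0 i)) ->
  (forall i, measurable_fun setT (fun t => Y t 0 i)) ->
  measurable_fun setT (fun p : T * T => (cap_kernel e (dot (X p.1) (Y p.2)))%:E).
Proof.
move=> mX mY; apply: measurable_cap_kernel; apply: measurable_dot => i.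
  exact: (measurableT_comp (mX i)).
exact: (measurableT_comp (mY i)).
Qed.

Let mf X f : (forall i, measurable_fun setT (fun t => X t 0 i)) -> lip f ->
  measurable_fun setT (fun t => (f (X t))%:E).
Proof. by move=> mX fl; apply/measurable_EFinP; exact: lip_measurable. Qed.

Variables (a : 'rV[R]_n) (a1 : dot a a = 1).

Definition mass X e := (\int[P]_t (cap_kernel e (dot (X t) a))%:E)%E.

Lemma mass_unit X e y : unit_law X -> dot y y = 1 ->
  (\int[P]_t (cap_kernel e (dot (X t) y))%:E = mass X e)%E.
Proof. by move=> [_ _ iX] y1; apply: iX; rewrite y1. Qed.

(** The double integral of k(X . Y') equals the mass of Y when Y' is integrated first, and the mass
    of X when X is. *)
Lemma mass_eq X Y e : unit_law X -> unit_law Y -> mass X e = mass Y e.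
Proof.
move=> uX uY; have [mX X1 _] := uX; have [mY Y1 _] := uY.
have := fubini_tonelli (m1 := P) (m2 := P) _ (mK e mX mY) (fun p => cap_kernel_ge0 e _).
rewrite /=.
under eq_integral do under eq_integral do rewrite dotC.
under eq_integral do rewrite (mass_unit _ uY (X1 _)).
under [X in _ = X -> _]eq_integral do rewrite (mass_unit _ uX (Y1 _)).
by rewrite !integral_cst; [rewrite /= probability_setT !mule1|..].
Qed.

Lemma mass_fin X e : unit_law X -> mass X e \is a fin_num.
Proof.
move=> [mX X1 _]; rewrite ge0_fin_numE; last first.
  by apply: integral_ge0 => t _; rewrite lee_fin cap_kernel_ge0.
apply: (@le_lt_trans _ _ (\int[P]_t (n%:R + `|1 - e|)%:E)%E); last first.
  by rewrite integral_cst//= probability_setT mule1 ltry.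
apply: ge0_le_integral => //=.
- by move=> t _; rewrite lee_fin cap_kernel_ge0.
- by apply: measurable_cap_kernel; apply: measurable_dot => // i; exact: measurable_cst.
move=> t _; rewrite lee_fin /cap_kernel ge_max addr_ge0//=.
have aM i : `|a 0 i| <= 1.
  by apply: le_trans (coord_le_enorm _ _) _; rewrite /enorm a1 sqrtr1.
have := le_dot_l1 (X t) aM; rewrite mul1r ler_norml => /andP[_ Xa].
have := l1_le_enorm (X t); rewrite /enorm X1 sqrtr1 mulr1.
have := ler_norm (- (1 - e)); rewrite normrN; lra.
Qed.

(** Outside the cap both sides vanish. Inside it the Euclidean distance is at most sqrt(2e), and the
    l1 norm is at most n times the Euclidean one. *)
Lemma cap_kernel_lip X Y f L e t t' : unit_law X -> unit_law Y -> 0 <= L ->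
  (forall x y, `|f x - f y| <= L * l1 (x - y)) ->
  f (X t) * cap_kernel e (dot (X t) (Y t')) <=
  (f (Y t') + L * (n%:R * Num.sqrt (2 * e))) * cap_kernel e (dot (X t) (Y t')).
Proof.
move=> [_ X1 _] [_ Y1 _] L0 fL.
rewrite {1 2}/cap_kernel; case: (leP (dot (X t) (Y t') - (1 - e)) 0) => [_|c0].
  by rewrite !mulr0.
rewrite ler_pM2r// -lerBlDl; apply: le_trans (le_trans (ler_norm _) (fL _ _)) _.
rewrite ler_wpM2l// (le_trans (l1_le_enorm _))// ler_wpM2l// /enorm ler_wsqrtr//.
by rewrite dotBl !dotBr X1 Y1 (dotC (Y t')); lra.
Qed.

(** Multiplied by the common mass, the integral of f(X) is the double integral of f(X) k(X . Y').
    Replacing f(X) by f(Y') + eta and integrating X first gives the mass times the integral of f(Y)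
    + eta; eta tends to 0 with the cap. *)
Lemma isotropic_integral_le X Y f : unit_law X -> unit_law Y -> lip f ->
  (forall x, 0 <= f x) -> (forall e, 0 < e -> (0 < mass Y e)%E) ->
  (\int[P]_t (f (X t))%:E <= \int[P]_t (f (Y t))%:E)%E.
Proof.
move=> uX uY fl f0 pos; have [mX X1 _] := uX; have [mY Y1 _] := uY.
have [L L0 fL] := fl.
have step e : 0 < e -> (\int[P]_t (f (X t))%:E <=
    \int[P]_t (f (Y t))%:E + (L * (n%:R * Num.sqrt (2 * e)))%:E)%E.
  move=> e0; set eta := L * _.
  have eta0 : 0 <= eta by rewrite !mulr_ge0// sqrtr_ge0.
  rewrite -(lee_pmul2l (mass_fin e uY) (pos e e0)).
  have K0 t t' : (0 <= (cap_kernel e (dot (X t) (Y t')))%:E)%E by rewrite lee_fin cap_kernel_ge0.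
  have mKX t : measurable_fun setT (fun t' => (cap_kernel e (dot (X t) (Y t')))%:E).
    by apply: measurable_cap_kernel; apply: measurable_dot => // i; exact: measurable_cst.
  have mKY t' : measurable_fun setT (fun t => (cap_kernel e (dot (X t) (Y t')))%:E).
    by apply: measurable_cap_kernel; apply: measurable_dot => // i; exact: measurable_cst.
  have mfK : measurable_fun setT (fun p : T * T =>
      ((f (X p.1))%:E * (cap_kernel e (dot (X p.1) (Y p.2)))%:E)%E).
    by apply: emeasurable_funM; [exact: (measurableT_comp (mf mX fl))|exact: mK].
  have mgK : measurable_fun setT (fun p : T * T =>
      ((f (Y p.2) + eta)%:E * (cap_kernel e (dot (X p.1) (Y p.2)))%:E)%E).
    apply: emeasurable_funM; last exact: mK.
    apply/measurable_EFinP; apply: measurable_funD => //.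
    by apply: (measurableT_comp (lip_measurable mY fl)).
  have -> : (mass Y e * \int[P]_t (f (X t))%:E = \int[P]_t \int[P]_t'
      ((f (X t))%:E * (cap_kernel e (dot (X t) (Y t')))%:E))%E.
    rewrite -ge0_integralZl//; last 3 first.
    - exact: mf.
    - by move=> t _; rewrite lee_fin.
    - by rewrite ltW// pos.
    apply: eq_integral => t _; rewrite ge0_integralZl// ?lee_fin// muleC; congr (_ * _)%E.
    by under eq_integral do rewrite dotC; rewrite mass_unit.
  have -> : (mass Y e * (\int[P]_t (f (Y t))%:E + eta%:E) = \int[P]_t \int[P]_t'
      ((f (Y t') + eta)%:E * (cap_kernel e (dot (X t) (Y t')))%:E))%E.
    rewrite (fubini_tonelli (m1 := P) (m2 := P) _ mgK)/=; last first.
      by move=> p; rewrite mule_ge0// lee_fin addr_ge0.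
    transitivity (\int[P]_t (mass Y e * (f (Y t) + eta)%:E))%E.
      rewrite ge0_integralZl//; last 3 first.
      - apply/measurable_EFinP; apply: measurable_funD => //; exact: lip_measurable.
      - by move=> t _; rewrite lee_fin addr_ge0.
      - by rewrite ltW// pos.
      congr (_ * _)%E; under [RHS]eq_integral do rewrite EFinD.
      rewrite ge0_integralD//; last 2 first.
      - by move=> t _; rewrite lee_fin.
      - exact: mf.
      by rewrite integral_cst//= probability_setT mule1.
    apply: eq_integral => t' _; rewrite ge0_integralZl// ?lee_fin ?addr_ge0// muleC.
    by rewrite mass_unit// (mass_eq e uX uY).
  apply: ge0_le_integral => //.
  - by move=> t _; apply: integral_ge0 => t' _; rewrite mule_ge0// lee_fin.
  - apply: (measurable_fun_fubini_tonelli_F (m2 := P) _ mfK) => p.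
    by rewrite mule_ge0// lee_fin.
  - apply: (measurable_fun_fubini_tonelli_F (m2 := P) _ mgK) => p.
    by rewrite mule_ge0// lee_fin addr_ge0.
  move=> t _; apply: ge0_le_integral => //.
  - by move=> t' _; rewrite mule_ge0// lee_fin.
  - by apply: emeasurable_funM => //.
  - apply: emeasurable_funM => //; apply/measurable_EFinP.
    by apply: measurable_funD => //; exact: lip_measurable.
  by move=> t' _; rewrite -!EFinM lee_fin; exact: cap_kernel_lip.
apply/lee_addgt0Pr => e e0.
(* A cap of parameter r^2 / 2 gives the error L n r, which is at most e. *)
pose r := e / (L * n%:R + 1).
have Ln : 0 <= L * n%:R by rewrite mulr_ge0.
have r0 : 0 < r by rewrite divr_gt0//; lra.
apply: le_trans (step (r ^+ 2 / 2) _) _; first by rewrite divr_gt0// exprn_gt0.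
rewrite leeD2l// lee_fin (_ : 2 * (r ^+ 2 / 2) = r ^+ 2); last by field.
rewrite sqrtr_sqr ger0_norm ?(ltW r0)// mulrA.
have <- : r * (L * n%:R + 1) = e by rewrite divfK// gt_eqF//; lra.
by rewrite mulrDr mulr1 mulrC lerDl (ltW r0).
Qed.

Lemma isotropic_integral_eq X Y f : unit_law X -> unit_law Y -> lip f ->
  (forall x, 0 <= f x) -> (forall e, 0 < e -> (0 < mass Y e)%E) ->
  (\int[P]_t (f (X t))%:E = \int[P]_t (f (Y t))%:E)%E.
Proof.
move=> uX uY fl f0 pos; apply/eqP; rewrite eq_le !isotropic_integral_le//.
by move=> e e0; rewrite (mass_eq e uX uY) pos.
Qed.

End kernel.

(** * Givens rotations of vectors and the Gram-Schmidt frame *)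

Section frame.
Context (R : realType) (n : nat).
Implicit Types (x y a b : 'rV[R]_n) (i j k : 'I_n).

Definition givens_row i j (c s : R) x : 'rV[R]_n := \row_k givens i j c s (fun l => x 0 l) k.

Lemma givens_rowD i j c s x y :
  givens_row i j c s (x + y) = givens_row i j c s x + givens_row i j c s y.
Proof.
apply/rowP => k; rewrite !mxE /givens !mxE.
by case: (k == i); [ring|case: (k == j); [ring|]].
Qed.

Lemma givens_rowZ i j c s e x : givens_row i j c s (e *: x) = e *: givens_row i j c s x.
Proof.
apply/rowP => k; rewrite !mxE /givens !mxE.
by case: (k == i); [ring|case: (k == j); [ring|]].
Qed.

Lemma dot_givens_row i j c s x y : i != j -> c ^+ 2 + s ^+ 2 = 1 ->
  dot (givens_row i j c s x) (givens_row i j c s y) = dot x y.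
Proof.
move=> ij cs; have ji : j != i by rewrite eq_sym.
rewrite !dotE (bigD1 i)//= [RHS](bigD1 i)//= (bigD1 j)//= [in RHS](bigD1 j)//= !addrA.
congr (_ + _); last first.
  by apply: eq_bigr => k /andP[/negbTE ki /negbTE kj]; rewrite !mxE /givens ki kj.
rewrite !mxE /givens !eqxx (negbTE ji).
transitivity ((c ^+ 2 + s ^+ 2) * (x 0 i * y 0 i + x 0 j * y 0 j)); first by ring.
by rewrite cs mul1r.
Qed.

(** Each rotation in a plane (i0, j) clears coordinate j and leaves a nonnegative length in
    coordinate i0. The second index [i1] guarantees at least one rotation, without which the sign of
    coordinate i0 could be wrong. *)
Lemma givens_orbit (S : Type) (m : 'rV[R]_n -> S) (i0 i1 : 'I_n) : i1 != i0 ->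
  (forall i j c s y, i != j -> c ^+ 2 + s ^+ 2 = 1 -> m y = m (givens_row i j c s y)) ->
  forall y, m y = m (enorm y *: delta_mx 0 i0).
Proof.
move=> i10 minv y.
have clear (r : seq 'I_n) : all (fun k => k != i0) r -> exists y',
    [/\ m y = m y', dot y y = dot y' y', forall k, k \in r -> y' 0 k = 0
      & r != [::] -> 0 <= y' 0 i0].
  elim: r => [|j r IH] /=; first by exists y.
  move=> /andP[j0 rall]; have [z [myz yz z0 _]] := IH rall.
  have ij : i0 != j by rewrite eq_sym.
  pose rho := Num.sqrt (z 0 i0 ^+ 2 + z 0 j ^+ 2).
  have rho2 : rho ^+ 2 = z 0 i0 ^+ 2 + z 0 j ^+ 2 by rewrite sqr_sqrtr// addr_ge0 ?sqr_ge0.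
  (* The rotation sends (z_i0, z_j) to (rho, 0); for rho = 0 the identity does. *)
  have [c [s [cs rc rs]]] : exists c s, [/\ c ^+ 2 + s ^+ 2 = 1,
      c * z 0 i0 + s * z 0 j = rho & - s * z 0 i0 + c * z 0 j = 0].
    have [r0|r0] := eqVneq rho 0.
      have : z 0 i0 ^+ 2 + z 0 j ^+ 2 == 0 by rewrite -rho2 r0 expr0n.
      rewrite paddr_eq0 ?sqr_ge0// !sqrf_eq0 => /andP[/eqP -> /eqP ->].
      by exists 1, 0; split; rewrite ?r0; ring.
    exists (z 0 i0 / rho), (z 0 j / rho); split.
    - by rewrite !expr_div_n -mulrDl -rho2 divff// sqrf_eq0.
    - transitivity ((z 0 i0 ^+ 2 + z 0 j ^+ 2) / rho); first by ring.
      by rewrite -rho2 expr2 mulfK.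
    - by ring.
  exists (givens_row i0 j c s z); split.
  - by rewrite myz; exact: minv.
  - by rewrite dot_givens_row.
  - move=> k; rewrite in_cons mxE /givens; case: (eqVneq k i0) => [->|ki].
      by rewrite (negbTE ij)/= => /(allP rall); rewrite /= eqxx.
    by case: (eqVneq k j) => [_ _|_] //=; exact: z0.
  - by move=> _; rewrite mxE /givens eqxx rc sqrtr_ge0.
have [|z [-> yz z0 zge0]] := clear [seq k <- enum 'I_n | k != i0]; first exact: filter_all.
have {}z0 k : k != i0 -> z 0 k = 0.
  by move=> ki; apply: z0; rewrite mem_filter /= ki mem_enum.
have {}zge0 : 0 <= z 0 i0.
  apply: zge0; apply/eqP => e; have := mem_filter (fun k => k != i0) i1 (enum 'I_n).
  by rewrite e in_nil /= i10 mem_enum.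
have -> : enorm y = z 0 i0.
  rewrite /enorm yz dotE (bigD1 i0)//= big1 ?addr0 => [|k ki]; last by rewrite z0// mul0r.
  by rewrite -expr2 sqrtr_sqr ger0_norm.
congr m; apply/rowP => k; rewrite !mxE /=.
by have [->|ki] := eqVneq k i0; rewrite ?mulr1// mulr0 z0.
Qed.

Definition dir x := (enorm x)^-1 *: x.

Lemma dot_dir x : x != 0 -> dot (dir x) (dir x) = 1.
Proof.
move=> x0; rewrite dotZl dotZr mulrA -expr2 exprVn enorm_sqr mulVf//.
by rewrite dot_eq0.
Qed.

Lemma hatE a b : hat a b = b - (dot b a / dot a a) *: a.
Proof.
rewrite /hat mulmxBr mulmx1 -scalemxAr mulmxA; congr (_ - _).
have -> : b *m a^T = (dot b a)%:M by apply/matrixP => k l; rewrite !ord1 [RHS]mxE eqxx.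
by rewrite mul_scalar_mx scalerA mulrC.
Qed.

Lemma dot_hat a b : a != 0 -> dot a (hat a b) = 0.
Proof.
move=> a0; rewrite hatE dotBr dotZr divfK ?dot_eq0//.
by rewrite (dotC b) subrr.
Qed.

(* [frame_comb 1 0] and [frame_comb (cos alpha) (sin alpha)] send the pair of Gaussian
   vectors to w and v. *)
Definition frame_comb p q a b := p *: dir a + q *: dir (hat a b).

Lemma dot_frame_comb p q a b : a != 0 -> hat a b != 0 ->
  dot (frame_comb p q a b) (frame_comb p q a b) = p ^+ 2 + q ^+ 2.
Proof.
move=> a0 h0; have ah : dot (dir a) (dir (hat a b)) = 0.
  by rewrite /dir dotZl dotZr dot_hat// !mulr0.
move: (dot_dir a0) (dot_dir h0) ah; rewrite /frame_comb.
move: (dir a) (dir (hat a b)) => x y xx yy xy.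
by rewrite dotDl !dotDr !dotZl !dotZr xx yy (dotC y) xy; ring.
Qed.

(** Gram-Schmidt uses only inner products and linear combinations, so it commutes with rotations. *)
Lemma frame_comb_givens i j c s p q a b : i != j -> c ^+ 2 + s ^+ 2 = 1 ->
  frame_comb p q (givens_row i j c s a) (givens_row i j c s b) =
  givens_row i j c s (frame_comb p q a b).
Proof.
move=> ij cs.
have dirE x : dir (givens_row i j c s x) = givens_row i j c s (dir x).
  by rewrite /dir /enorm dot_givens_row// givens_rowZ.
rewrite /frame_comb hatE !dot_givens_row// -scaleNr -givens_rowZ -givens_rowD !dirE.
by rewrite -!givens_rowZ -givens_rowD scaleNr -hatE.
Qed.

Context d (T : measurableType d).

Lemma measurable_dir (X : T -> 'rV[R]_n) :
  (forall i, measurable_fun setT (fun t => X t 0 i)) ->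
  forall i, measurable_fun setT (fun t => dir (X t) 0 i).
Proof.
(* Inverse and square root become real powers, which are measurable on the whole line; at 0 both
   expressions for the inverse give 0. *)
move=> mX i; have -> : (fun t => dir (X t) 0 i) =
    (fun t => ((dot (X t) (X t)) `^ (2^-1)) `^ (-1) * X t 0 i).
  by apply/funext => t; rewrite mxE powR12_sqrt ?dot_ge0// powR_inv1// sqrtr_ge0.
apply: measurable_funM => //.
apply: (measurableT_comp (measurable_powR (-1))).
apply: (measurableT_comp (measurable_powR (2^-1))).
under eq_fun do rewrite dotE.
by apply: measurable_sum => k; exact: measurable_funM.
Qed.

Lemma measurable_hat (X Y : T -> 'rV[R]_n) :
  (forall i, measurable_fun setT (fun t => X t 0 i)) ->
  (forall i, measurable_fun setT (fun t => Y t 0 i)) ->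
  forall i, measurable_fun setT (fun t => hat (X t) (Y t) 0 i).
Proof.
move=> mX mY i; have -> : (fun t => hat (X t) (Y t) 0 i) =
    (fun t => Y t 0 i - (\sum_k Y t 0 k * X t 0 k) *
      ((\sum_k X t 0 k * X t 0 k) `^ (-1)) * X t 0 i).
  by apply/funext => t; rewrite hatE !mxE -!dotE powR_inv1// dot_ge0.
apply: measurable_funB => //; apply: measurable_funM => //; apply: measurable_funM.
  by apply: measurable_sum => k; exact: measurable_funM.
apply: (measurableT_comp (measurable_powR (-1))).
by apply: measurable_sum => k; exact: measurable_funM.
Qed.

Lemma measurable_frame_comb p q (X Y : T -> 'rV[R]_n) :
  (forall i, measurable_fun setT (fun t => X t 0 i)) ->
  (forall i, measurable_fun setT (fun t => Y t 0 i)) ->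
  forall i, measurable_fun setT (fun t => frame_comb p q (X t) (Y t) 0 i).
Proof.
move=> mX mY i.
have -> : (fun t => frame_comb p q (X t) (Y t) 0 i) =
    (fun t => p * dir (X t) 0 i + q * dir (hat (X t) (Y t)) 0 i).
  by apply/funext => t; rewrite /frame_comb mxE [X in X + _]mxE [X in _ + X]mxE.
apply: measurable_funD; apply: measurable_funM => //; apply: measurable_dir => //.
exact: measurable_hat.
Qed.

End frame.

(** * Nondegeneracy and isotropy of the Gaussian frame *)

Lemma measurable_graph (R : realType) d (T : measurableType d) (I : finType) (Z : T -> I -> R)
    (k l l' k' : I) :
  (forall i, measurable_fun setT (fun t => Z t i)) ->
  measurable [set t | Z t l != 0 /\ Z t l * Z t k = Z t l' * Z t k'].
Proof.
move=> mZ.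
have -> : [set t | Z t l != 0 /\ Z t l * Z t k = Z t l' * Z t k'] =
    ~` ((fun t => Z t l) @^-1` [set 0]) `&`
    ((fun t => Z t l * Z t k - Z t l' * Z t k') @^-1` [set 0]).
  apply/seteqP; split => t /=.
    by move=> [/eqP zl /eqP zz]; split => //; apply/eqP; rewrite subr_eq0.
  by move=> [/eqP zl /eqP zz]; split => //; apply/eqP; rewrite -subr_eq0.
apply: measurableI.
  by apply: measurableC; rewrite -[X in measurable X]setTI; exact: mZ.
rewrite -[X in measurable X]setTI.
have mg : measurable_fun setT (fun t => Z t l * Z t k - Z t l' * Z t k').
  by apply: measurable_funB; apply: measurable_funM; exact: mZ.
by apply: mg => //; exact: measurable_set1.
Qed.

(** Once coordinate [k] is resampled and the others are frozen, the equation leaves it a single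
    value, and the normal law has no atoms. *)
Lemma iid_normal_graph_null (R : realType) d (T : measurableType d) (P : probability T R)
    (I : finType) (Z : T -> I -> R) (k l l' k' : I) :
  iid_normal P Z -> k \notin [:: l; l'; k'] ->
  P [set t | Z t l != 0 /\ Z t l * Z t k = Z t l' * Z t k'] = 0%E.
Proof.
move=> iid; rewrite !inE !negb_or => /and3P[kl kl' kk'].
pose E := [set z : funspace R I | z l != 0 /\ z l * z k = z l' * z k'].
have mE : measurable E.
  exact: (measurable_graph k l l' k' (@measurable_funspace_coord R I)).
have iid2 := iid_normal_resample (fun i => i == k) iid.
have := iid_normal_law iid iid2 mE; rewrite /= => ->.
rewrite /product_measure1 integral0_eq// => t _ /=.
set S := xsection _ t.
have lk : (l == k) = false by rewrite eq_sym (negbTE kl).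
have l'k : (l' == k) = false by rewrite eq_sym (negbTE kl').
have k'k : (k' == k) = false by rewrite eq_sym (negbTE kk').
have SE : S = [set t' | Z t l != 0 /\ Z t l * Z t' k = Z t l' * Z t k'].
  apply/seteqP; split => t'; rewrite /S /xsection /=.
    rewrite inE /E /=. by rewrite lk l'k k'k eqxx.
  by rewrite inE /E /= lk l'k k'k eqxx.
have [zl|zl] := eqVneq (Z t l) 0.
  rewrite SE (_ : [set _ | _] = set0) ?measure0//; apply/seteqP; split => t' //=.
  by rewrite zl eqxx => -[].
have -> : S = [set t' | [set Z t l' * Z t k' / Z t l] (Z t' k)].
  rewrite SE; apply/seteqP; split => t' /=.
    by move=> [_ <-]; rewrite mulrC mulKf.
  by move=> ->; split => //; rewrite mulrC divfK.
rewrite (iid_normal_marginal k iid); last exact: measurable_set1.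
exact: normal_prob_set1.
Qed.

Section uniform_frame.
Context (R : realType) (n : nat) d (T : measurableType d) (P : probability T R).
Variables (wb ub : T -> 'rV[R]_n).
Hypothesis iZ : iid_normal P (join_families wb ub).

Let mwb i : measurable_fun setT (fun t => wb t 0 i).
Proof. exact: (iZ.1 (inl i)). Qed.

Let mub i : measurable_fun setT (fun t => ub t 0 i).
Proof. exact: (iZ.1 (inr i)). Qed.

Let mcomb p q i : measurable_fun setT (fun t => frame_comb p q (wb t) (ub t) 0 i).
Proof. exact: measurable_frame_comb. Qed.

(** Rotating both Gaussian vectors preserves their joint law and rotates the frame; rotating y as
    well leaves the inner product unchanged. *)
Lemma cap_kernel_frame_comb_givens e p q (i j : 'I_n) c s y : i != j -> c ^+ 2 + s ^+ 2 = 1 ->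
  (\int[P]_t (cap_kernel e (dot (frame_comb p q (wb t) (ub t)) y))%:E =
   \int[P]_t (cap_kernel e (dot (frame_comb p q (wb t) (ub t)) (givens_row i j c s y)))%:E)%E.
Proof.
move=> ij cs.
pose Z' t := givens (inl i : 'I_n + 'I_n) (inl j) c s
  (givens (inr i : 'I_n + 'I_n) (inr j) c s (join_families wb ub t)).
have iZ' : iid_normal P Z'.
  by apply: iid_normal_givens => //; apply: iid_normal_givens.
pose F (z : funspace R ('I_n + 'I_n)%type) := (cap_kernel e (dot
  (frame_comb p q (\row_k z (inl k)) (\row_k z (inr k))) (givens_row i j c s y)))%:E.
have mF : measurable_fun setT F.
  apply: measurable_cap_kernel; apply: measurable_dot => [k|k]; last exact: measurable_cst.
  apply: measurable_frame_comb => l.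
    have -> : (fun z : funspace R ('I_n + 'I_n)%type => (\row_k z (inl k)) 0 l) = (fun z => z (inl l)).
      by apply/funext => z; rewrite mxE.
    exact: measurable_funspace_coord.
  have -> : (fun z : funspace R ('I_n + 'I_n)%type => (\row_k z (inr k)) 0 l) = (fun z => z (inr l)).
    by apply/funext => z; rewrite mxE.
  exact: measurable_funspace_coord.
have FZ t : F (join_families wb ub t) =
    (cap_kernel e (dot (frame_comb p q (wb t) (ub t)) (givens_row i j c s y)))%:E.
  rewrite /F; have -> : \row_k join_families wb ub t (inl k) = wb t by apply/rowP => k; rewrite mxE.
  by have -> : \row_k join_families wb ub t (inr k) = ub t by apply/rowP => k; rewrite mxE.
have FZ' t : F (Z' t) = (cap_kernel e (dot (frame_comb p q (wb t) (ub t)) y))%:E.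
  rewrite /F; have -> : \row_k Z' t (inl k) = givens_row i j c s (wb t).
    by apply/rowP => k; rewrite !mxE.
  have -> : \row_k Z' t (inr k) = givens_row i j c s (ub t).
    by apply/rowP => k; rewrite !mxE.
  by rewrite frame_comb_givens// dot_givens_row.
move: F mF FZ FZ' => F mF FZ FZ'.
transitivity (\int[P]_t F (Z' t))%E.
  by apply: eq_integral => t _; rewrite FZ'.
rewrite (iid_normal_integral iZ' iZ mF).
by apply: eq_integral => t _; rewrite FZ.
Qed.

Variables (i0 i1 : 'I_n) (i10 : i1 != i0).

Lemma isotropic_frame_comb p q : isotropic_law P (fun t => frame_comb p q (wb t) (ub t)).
Proof.
move=> e y y' yy.
pose m y := (\int[P]_t (cap_kernel e (dot (frame_comb p q (wb t) (ub t)) y))%:E)%E.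
have orb z : m z = m (enorm z *: delta_mx 0 i0).
  by apply: givens_orbit i10 _ z => i j c s z; exact: cap_kernel_frame_comb_givens.
suff : m y = m y' by [].
move: m orb => m orb.
by rewrite (orb y) (orb y') /enorm yy.
Qed.

(** If the projection vanishes, [ub] is proportional to [wb] and the minor on the coordinates i0, i1
    is zero. When coordinate i0 of [wb] is nonzero this determines coordinate i1 of [ub], a null
    event. *)
Lemma ae_nondegenerate : {ae P, forall t, wb t != 0 /\ hat (wb t) (ub t) != 0}.
Proof.
pose N1 := [set t | [set (0 : R)] (wb t 0 i0)].
pose N2 := [set t | wb t 0 i0 != 0 /\ wb t 0 i0 * ub t 0 i1 = wb t 0 i1 * ub t 0 i0].
have N10 : P.-negligible N1.
  apply/negligibleP.
    by rewrite -[X in measurable X]setTI; apply: mwb => //; exact: measurable_set1.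
  by apply: etrans (iid_normal_marginal (inl i0) iZ (measurable_set1 0)) _; exact: normal_prob_set1.
have N20 : P.-negligible N2.
  have kn : inr i1 \notin [:: inl i0; inl i1; inr i0 : 'I_n + 'I_n].
    by rewrite !inE !negb_or; apply/and3P; split.
  apply/negligibleP; last exact: (iid_normal_graph_null iZ kn).
  exact: (measurable_graph (inr i1) (inl i0) (inl i1) (inr i0) iZ.1).
apply: negligibleS (negligibleU N10 N20) => t /= h.
have [w0|w0] := eqVneq (wb t 0 i0) 0; [by left|right; split => //].
have wb0 : wb t != 0 by apply: contra w0 => /eqP ->; rewrite mxE.
have [h0|h0] := eqVneq (hat (wb t) (ub t)) 0; last by exfalso; apply: h.
move: h0; rewrite hatE => /eqP; rewrite subr_eq0 => /eqP ->.
by rewrite !mxE; ring.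
Qed.

End uniform_frame.

Section unitize.
Context (R : realType) (n : nat) d (T : measurableType d) (P : probability T R).
Variables (a : 'rV[R]_n) (a1 : dot a a = 1) (X : T -> 'rV[R]_n).
Hypotheses (mX : forall i, measurable_fun setT (fun t => X t 0 i))
           (uX : {ae P, forall t, dot (X t) (X t) = 1}).

(* Changes X on a null set so that it takes values in the unit sphere. *)
Definition unitize t := if dot (X t) (X t) == 1 then X t else a.

Lemma measurable_unitize i : measurable_fun setT (fun t => unitize t 0 i).
Proof.
have -> : (fun t => unitize t 0 i) =
    (fun t => if dot (X t) (X t) == 1 then X t 0 i else a 0 i).
  by apply/funext => t; rewrite /unitize; case: ifP.
apply: measurable_fun_ifT => //; apply: measurable_fun_eqr => //; exact: measurable_dot.
Qed.

Lemma dot_unitize t : dot (unitize t) (unitize t) = 1.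
Proof. by rewrite /unitize; case: ifPn => [/eqP|]. Qed.

Lemma integral_unitize (F : 'rV[R]_n -> R) :
  measurable_fun setT (fun t => (F (X t))%:E) ->
  measurable_fun setT (fun t => (F (unitize t))%:E) ->
  (\int[P]_t (F (unitize t))%:E = \int[P]_t (F (X t))%:E)%E.
Proof.
move=> m1 m2; apply: ae_eq_integral => //.
by apply: filterS uX => t Xt _; rewrite /unitize Xt eqxx.
Qed.

Lemma mass_unitize e : mass P a unitize e = mass P a X e.
Proof.
apply: (@integral_unitize (fun x => cap_kernel e (dot x a))).
  by apply: measurable_cap_kernel; apply: measurable_dot => // i; exact: measurable_cst.
apply: measurable_cap_kernel; apply: measurable_dot; first exact: measurable_unitize.
by move=> i; exact: measurable_cst.
Qed.

Lemma unit_law_unitize : isotropic_law P X -> unit_law P unitize.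
Proof.
move=> iX; split; [exact: measurable_unitize|exact: dot_unitize|].
have E e y : (\int[P]_t (cap_kernel e (dot (unitize t) y))%:E =
    \int[P]_t (cap_kernel e (dot (X t) y))%:E)%E.
  apply: (@integral_unitize (fun x => cap_kernel e (dot x y))).
    by apply: measurable_cap_kernel; apply: measurable_dot => // i; exact: measurable_cst.
  apply: measurable_cap_kernel; apply: measurable_dot; first exact: measurable_unitize.
  by move=> i; exact: measurable_cst.
by move=> e y y' yy; rewrite !E; exact: iX.
Qed.

End unitize.

(** * Expectations over the Gaussian frame *)

Section frame_law.
Context (R : realType) (n : nat) d (T : measurableType d) (P : probability T R).
Variables (wb ub : T -> 'rV[R]_n) (i0 i1 : 'I_n) (i10 : i1 != i0).
Hypothesis iZ : iid_normal P (join_families wb ub).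

Let iwb : iid_normal P (fun t i => wb t 0 i) := iid_normal_inl iZ.
Let mwb : forall i, measurable_fun setT (fun t => wb t 0 i) := iwb.1.
Let mub i : measurable_fun setT (fun t => ub t 0 i) := iZ.1 (inr i).

Let a : 'rV[R]_n := delta_mx 0 i0.

Let a1 : dot a a = 1.
Proof.
rewrite dotE (bigD1 i0)//= big1 ?addr0; first by rewrite !mxE !eqxx mulr1.
by move=> k /negbTE ki; rewrite !mxE ki andbF mul0r.
Qed.

Lemma enorm_le_l1 (x : 'rV[R]_n) : enorm x <= l1 x.
Proof.
rewrite -ler_sqr ?nnegrE ?sqrtr_ge0 ?l1_ge0// enorm_sqr dotE expr2 {1}/l1 mulr_suml.
apply: ler_sum => i _; rewrite -expr2 -real_normK ?num_real// expr2 ler_wpM2l//.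
by rewrite /l1 (bigD1 i)//= lerDl sumr_ge0.
Qed.

Lemma mass_dir_gt0 e : 0 < e -> (0 < mass P a (fun t => dir (wb t)) e)%E.
Proof.
move=> e0; pose e' := Num.min e 1; have e'0 : 0 < e' by rewrite lt_min e0 ltr01.
have e'e : e' <= e by rewrite ge_min lexx.
have e'1 : e' <= 1 by rewrite ge_min lexx orbT.
(* For wb within de of a in each coordinate, wb . a > 1 - de and |wb| <= 1 + (n + 1) de. The choice
   (n + 2) de = e' / 2 makes the cosine at least 1 - e' / 2, so the kernel is at least e / 2; e' <=
   1 keeps the signs right. *)
pose de := e' / (2 * (n%:R + 2)).
have n0 : 0 <= n%:R :> R by [].
have den : de * (2 * (n%:R + 2)) = e' by rewrite divfK// gt_eqF//; lra.
have de0 : 0 < de by rewrite divr_gt0//; lra.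
pose B := [set t | forall i, `|wb t 0 i - a 0 i| < de].
have PB : (0 < P B)%E by exact: iid_normal_ball_gt0.
have mB : measurable B.
  apply: (measurable_forall (B := fun i => [set r | `|r - a 0 i| < de]) mwb) => i.
  have -> : [set r | `|r - a 0 i| < de] = `]a 0 i - de, a 0 i + de[%classic.
    by apply/seteqP; split => r; rewrite /= in_itv/= ltr_distl.
  exact: measurable_itv.
have mk : measurable_fun setT (fun t => (cap_kernel e (dot (dir (wb t)) a))%:E).
  apply: measurable_cap_kernel; apply: measurable_dot; first exact: measurable_dir.
  by move=> i; exact: measurable_cst.
apply: (@lt_le_trans _ _ (\int[P]_(t in B) (e / 2)%:E)%E).
  by rewrite integral_cst//= mule_gt0// lte_fin divr_gt0.
apply: (@le_trans _ _ (\int[P]_(t in B) (cap_kernel e (dot (dir (wb t)) a))%:E)%E); last first.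
  by apply: ge0_subset_integral => // t _; rewrite lee_fin cap_kernel_ge0.
apply: ge0_le_integral => //.
- by move=> t _; rewrite lee_fin divr_ge0// ltW.
- exact: measurable_funTS.
move=> t Bt; rewrite lee_fin /cap_kernel le_max; apply/orP; right.
have dota : dot (wb t) a = wb t 0 i0.
  rewrite dotE (bigD1 i0)//= big1 ?addr0; first by rewrite mxE !eqxx mulr1.
  by move=> k /negbTE ki; rewrite mxE ki andbF mulr0.
have l1le : l1 (wb t) <= 1 + (n%:R + 1) * de.
  apply: le_trans (_ : l1 a + l1 (wb t - a) <= _).
    by have := l1D a (wb t - a); rewrite addrC subrK.
  rewrite [l1 a](_ : _ = 1); last first.
    rewrite /l1 (bigD1 i0)//= big1 ?addr0; first by rewrite mxE !eqxx normr1.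
    by move=> k /negbTE ki; rewrite mxE ki andbF normr0.
  rewrite lerD2l; apply: (@le_trans _ _ (\sum_(i < n) de)).
    by apply: ler_sum => i _; rewrite !mxE; have := Bt i; rewrite mxE => /ltW.
  rewrite sumr_const card_ord -mulr_natl; lra.
have w0 : 1 - de < wb t 0 i0.
  by have := Bt i0; rewrite mxE !eqxx ltr_distl => /andP[].
have de1 : de < 1 by nra.
have wn0 : 0 < enorm (wb t).
  by apply: lt_le_trans (coord_le_enorm _ i0); rewrite ger0_norm; lra.
suff : 1 - e / 2 <= dot (dir (wb t)) a by lra.
rewrite dotZl dota [_^-1 * _]mulrC ler_pdivlMr//.
apply: (@le_trans _ _ ((1 - e' / 2) * enorm (wb t))).
  by rewrite ler_wpM2r ?(ltW wn0)//; lra.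
have := le_trans (enorm_le_l1 (wb t)) l1le => wl.
apply: (@le_trans _ _ ((1 - e' / 2) * (1 + (n%:R + 1) * de))).
  by rewrite ler_wpM2l//; lra.
nra.
Qed.

Lemma l1_dir_le (x : 'rV[R]_n) : l1 (dir x) <= n%:R.
Proof.
have [->|x0] := eqVneq x 0.
  by rewrite /dir scaler0 /l1 big1 // => i _; rewrite mxE normr0.
by apply: le_trans (l1_le_enorm _) _; rewrite /enorm dot_dir// sqrtr1 mulr1.
Qed.

Lemma l1_dir_integrable (Y : T -> 'rV[R]_n) :
  (forall i, measurable_fun setT (fun t => Y t 0 i)) ->
  P.-integrable setT (fun t => (l1 (dir (Y t)))%:E).
Proof.
move=> mY; have : P.-integrable setT (fun t : T => (n%:R)%:E).
  exact: finite_measure_integrable_cst.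
apply: le_integrable => //.
  apply/measurable_EFinP; apply: measurable_sum => i.
  by apply: measurableT_comp => //; exact: measurable_dir.
by move=> t _; rewrite /= lee_fin !ger0_norm ?l1_ge0// l1_dir_le.
Qed.

(** Normalized by s, the combination is almost surely a unit vector with isotropic law, and so is
    the first frame vector. The kernel comparison identifies their expectations, and homogeneity
    restores s. *)
Lemma frame_isotropic f p q : lip f -> poshom f -> q != 0 ->
  (\int[P]_t (f (p *: dir (wb t) + q *: dir (hat (wb t) (ub t))))%:E =
   (Num.sqrt (p ^+ 2 + q ^+ 2))%:E * \int[P]_t (f (dir (wb t)))%:E)%E.
Proof.
move=> fl fh q0; set s := Num.sqrt _.
have pq0 : 0 < p ^+ 2 + q ^+ 2 by rewrite ltr_wpDl ?sqr_ge0// lt_def sqrf_eq0 q0 sqr_ge0.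
have s0 : 0 < s by rewrite sqrtr_gt0.
have ss : s ^+ 2 = p ^+ 2 + q ^+ 2 by rewrite sqr_sqrtr// ltW.
have cs : (p / s) ^+ 2 + (q / s) ^+ 2 = 1.
  by rewrite !expr_div_n -mulrDl -ss divff// sqrf_eq0 gt_eqF.
pose X t := frame_comb (p / s) (q / s) (wb t) (ub t).
pose Y t := frame_comb 1 0 (wb t) (ub t).
have YE t : Y t = dir (wb t) by rewrite /Y /frame_comb scale1r scale0r addr0.
have mX i : measurable_fun setT (fun t => X t 0 i) by exact: measurable_frame_comb.
have mY i : measurable_fun setT (fun t => Y t 0 i) by exact: measurable_frame_comb.
have nondeg := ae_nondegenerate iZ i10.
have uX : {ae P, forall t, dot (X t) (X t) = 1}.
  by apply: filterS nondeg => t [w0 h0]; rewrite dot_frame_comb.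
have uY : {ae P, forall t, dot (Y t) (Y t) = 1}.
  by apply: filterS nondeg => t [w0 h0]; rewrite dot_frame_comb// expr1n expr0n addr0.
have UX := unit_law_unitize a1 mX uX (isotropic_frame_comb iZ i10 _ _).
have UY := unit_law_unitize a1 mY uY (isotropic_frame_comb iZ i10 _ _).
have pos e : 0 < e -> (0 < mass P a (unitize a Y) e)%E.
  move=> e0; rewrite mass_unitize// (_ : Y = fun t => dir (wb t)); first exact: mass_dir_gt0.
  by apply/funext.
have mfX := lip_measurable mX fl.
have mfY := lip_measurable mY fl.
have mfUX := lip_measurable (measurable_unitize a mX) fl.
have mfUY := lip_measurable (measurable_unitize a mY) fl.
have [L L0 fL] := fl.
have fbound V t : unit_law P V -> `|f (V t)| <= L * n%:R.
  move=> [_ V1 _]; have := fL (V t) 0; rewrite (poshom0 fh) !subr0 => /le_trans; apply.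
  by rewrite ler_wpM2l// (le_trans (l1_le_enorm _))// /enorm V1 sqrtr1 mulr1.
have fint V : unit_law P V -> P.-integrable setT (fun t => (f (V t))%:E).
  move=> uV; have [mV _ _] := uV.
  have : P.-integrable setT (fun t : T => (L * n%:R)%:E).
    exact: finite_measure_integrable_cst.
  apply: le_integrable => //; first by apply/measurable_EFinP; exact: lip_measurable.
  by move=> t _; rewrite /= lee_fin (le_trans (fbound V t uV))// ler_norm.
have eqXY : (\int[P]_t (f (unitize a X t))%:E = \int[P]_t (f (unitize a Y t))%:E)%E.
  (* The comparison wants a nonnegative function everywhere. On the unit sphere f >= - L n, so there
     the absolute value changes nothing and g is f plus a constant. *)
  pose g x := `|f x + L * n%:R|.
  have gl : lip g.
    exists L => // x y; apply: le_trans (ler_dist_dist _ _) _.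
    by rewrite opprD addrACA subrr addr0.
  have gE V : unit_law P V -> (\int[P]_t (g (V t))%:E = \int[P]_t (f (V t))%:E + (L * n%:R)%:E)%E.
    move=> uV; rewrite -[((L * _)%:E)%E]mule1 -(probability_setT P) -integral_cst//.
    rewrite -integralD//; last 2 first.
    - exact: fint.
    - exact: finite_measure_integrable_cst.
    apply: eq_integral => t _; rewrite -EFinD /g ger0_norm//.
    by have := fbound V t uV; rewrite ler_norml; lra.
  have := isotropic_integral_eq a1 UX UY gl (fun x => normr_ge0 _) pos.
  rewrite (gE _ UX) (gE _ UY).
  have /fineK <- := integrable_fin_num measurableT (fint _ UX).
  have /fineK <- := integrable_fin_num measurableT (fint _ UY).
  by rewrite -!EFinD => -[/addIr ->].
transitivity (\int[P]_t (s%:E * (f (X t))%:E))%E.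
  apply: eq_integral => t _; rewrite -EFinM -fh ?ltW// /X /frame_comb scalerDr !scalerA.
  by rewrite ![s * _]mulrC !divfK// gt_eqF.
rewrite (ae_eq_integral (fun t => s%:E * (f (unitize a X t))%:E)%E)//; last 3 first.
- by apply: emeasurable_funM => //; exact/measurable_EFinP.
- by apply: emeasurable_funM => //; exact/measurable_EFinP.
- by apply: filterS uX => t Xt _; rewrite /unitize Xt eqxx.
rewrite integralZl//; last exact: fint.
rewrite eqXY integral_unitize//; [|exact/measurable_EFinP|exact/measurable_EFinP].
by congr (_ * _)%E; apply: eq_integral => t _; rewrite YE.
Qed.

End frame_law.

(** * The ratio *)

Section range_gt0.
Context (R : realType) (n : nat) d (T : measurableType d) (P : probability T R).
Variables (C : set 'rV[R]_n) (C_compact : compact C) (C_nonempty : C !=set0).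

(** For distinct points x, y of C and z = x - y, the range at w is at least w . z, which is positive
    when the Gaussian vector [wb] is near z. This has positive probability, so the range cannot
    vanish almost everywhere. *)
Lemma integral_rangeC_gt0 (w wb : T -> 'rV[R]_n) : iid_normal P (fun t i => wb t 0 i) ->
  P.-integrable setT (fun t => (rangeC C (w t))%:E) ->
  (forall t x, 0 < dot (wb t) x -> 0 < dot (w t) x) -> ~ is_subset1 C ->
  (0 < \int[P]_t (rangeC C (w t))%:E)%E.
Proof.
move=> iwb ir pos nC.
have [x [y [Cx Cy xy]]] : exists x y, [/\ C x, C y & x != y].
  apply: contra_notP nC => nxy x y Cx Cy; apply: contrapT => /eqP xy.
  by apply: nxy; exists x, y.
have range_ge v : dot v (x - y) <= rangeC C v.
  by rewrite rangeC_eq dotBr lerD ?dot_le_maxC// -dotNl dot_le_maxC.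
have range0 v : 0 <= rangeC C v.
  rewrite rangeC_eq; have := dot_le_maxC C_compact C_nonempty v Cx.
  by have := dot_le_maxC C_compact C_nonempty (- v) Cx; rewrite dotNl; lra.
rewrite lt_def integral_ge0 ?andbT => [|t _]; last by rewrite lee_fin.
apply/negP => /eqP int0.
have mr := measurable_int P ir.
have : ae_eq P setT (fun t => (rangeC C (w t))%:E) (cst 0%E).
  apply/ae_eq_integral_abs => //; rewrite -[RHS]int0.
  by apply: eq_integral => t _; rewrite gee0_abs// lee_fin.
move=> [N [mN PN0 subN]].
pose z := x - y; have zz : 0 < dot z z by rewrite lt_def dot_ge0 dot_eq0 subr_eq0 xy.
(* Then |(wb - z) . z| <= e |z|_1 < z . z, so wb . z > 0. *)
pose e := dot z z / (l1 z + 1).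
have l0 := l1_ge0 z.
have e0 : 0 < e by rewrite divr_gt0//; lra.
have := iid_normal_ball_gt0 (fun i => z 0 i) e0 iwb.
apply/negP; rewrite -leNgt -PN0; apply: le_measure; rewrite ?inE//.
  apply: (measurable_forall (B := fun i => [set r | `|r - z 0 i| < e]) iwb.1) => i.
  have -> : [set r | `|r - z 0 i| < e] = `]z 0 i - e, z 0 i + e[%classic.
    by apply/seteqP; split => r; rewrite /= in_itv/= ltr_distl.
  exact: measurable_itv.
move=> t /= Bt; apply: subN => /= /(_ Logic.I) [] rt.
have : 0 < dot (w t) z; last by have := range_ge (w t); rewrite -/z rt; lra.
apply: pos; have -> : wb t = z + (wb t - z) by rewrite addrC subrK.
rewrite dotDl.
have h : `|dot (wb t - z) z| <= e * l1 z.
  by rewrite dotC; apply: le_dot_l1 => i; rewrite mxE [X in _ + X]mxE; apply: ltW; exact: Bt.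
have : e * (l1 z + 1) = dot z z by rewrite divfK// gt_eqF//; lra.
by move: h; rewrite ler_norml => /andP[+ _]; lra.
Qed.

End range_gt0.

(** For a singleton C both expectations are 0, so the quotient is asserted only when C has two
    points and the product form carries the general statement. Distribution 2 requires n > 1, since
    in dimension 1 the projected vector is almost surely 0. *)
Theorem theorem2 (R : realType) (n : nat) (alpha : R) (C : set 'rV[R]_n)
    (halpha : 0 < alpha < pi / 2) (C_compact : compact C) (C_nonempty : C !=set0)
    (d : measure_display) (T : measurableType d) (P : probability T R)
    (w v : T -> 'rV[R]_n)
    (hwv : distribution1 P alpha w v \/
           ((1 < n)%N /\ distribution2 P alpha w v)) :
  [/\ P.-integrable setT (fun t => (loss C (v t) (w t))%:E),
      P.-integrable setT (fun t => (rangeC C (w t))%:E),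
      ('E_P[fun t => loss C (v t) (w t)] =
        ((1 - cos alpha) / 2)%:E * 'E_P[fun t => rangeC C (w t)])%E
    & ~ is_subset1 C ->
      ('E_P[fun t => loss C (v t) (w t)] / 'E_P[fun t => rangeC C (w t)] =
        ((1 - cos alpha) / 2)%:E)%E].
Proof.
have sin0 : sin alpha != 0 by rewrite gt_eqF// sin_gt0_pihalf.
(* What the two distributions have in common. The Gaussian vector [wb] serves the positivity of the
   expected range: it is w itself for Distribution 1, and the vector normalized to w for
   Distribution 2. *)
suff [u [wb [mw mu [iw iu iso vE [iwb pos]]]]] : exists u wb : T -> 'rV[R]_n,
    [/\ forall i, measurable_fun setT (fun t => w t 0 i),
        forall i, measurable_fun setT (fun t => u t 0 i)
      & [/\ P.-integrable setT (fun t => (l1 (w t))%:E),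
            P.-integrable setT (fun t => (l1 (u t))%:E),
            forall f, lip f -> poshom f -> forall a b : R, b != 0 ->
              (\int[P]_t (f (a *: w t + b *: u t))%:E =
               (Num.sqrt (a ^+ 2 + b ^+ 2))%:E * \int[P]_t (f (w t))%:E)%E,
            forall t, v t = cos alpha *: w t + sin alpha *: u t
          & iid_normal P (fun t i => wb t 0 i) /\
            forall t x, 0 < dot (wb t) x -> 0 < dot (w t) x]].
  have [il el] := expected_loss mw mu iw iu iso C_compact C_nonempty sin0.
  have {vE} vE : v = fun t => cos alpha *: w t + sin alpha *: u t by exact/funext.
  have ir := integrable_rangeC mw mu iw iu C_compact C_nonempty.
  have EE (X : T -> R) : ('E_P[X] = \int[P]_t (X t)%:E)%E by rewrite unlock.
  rewrite vE !EE; split; [exact: il|exact: ir|exact: el|move=> nC; rewrite el].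
  have r0 := integral_rangeC_gt0 C_compact C_nonempty iwb ir pos nC.
  have rfin := integrable_fin_num measurableT ir.
  rewrite -(fineK rfin) in r0 *; rewrite lte_fin in r0.
  by rewrite inver gt_eqF// -!EFinM mulfK// gt_eqF.
case: hwv => [[u [gw gu wu vE]]|[n1 [wb [ub [gw gu wu wE vE]]]]].
  have iZ := independent_gaussians_iid gw gu wu.
  have iw := standard_gaussian_iid gw; have iu := standard_gaussian_iid gu.
  exists u, w; split; [exact: iw.1|exact: iu.1|split => //].
  - exact: iid_normal_l1_integrable.
  - exact: iid_normal_l1_integrable.
  - by move=> f fl fh a b b0; exact: iid_normal_comb_isotropic.
have iZ := independent_gaussians_iid gw gu wu.
have iw := standard_gaussian_iid gw; have iu := standard_gaussian_iid gu.
pose i0 : 'I_n := Ordinal (ltnW n1); pose i1 : 'I_n := Ordinal n1.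
have i10 : i1 != i0 by [].
have {}wE : w = fun t => dir (wb t) by exact/funext.
have mh := measurable_hat iw.1 iu.1.
rewrite wE; exists (fun t => dir (hat (wb t) (ub t))), wb; split.
- exact: measurable_dir iw.1.
- exact: measurable_dir mh.
split.
- exact: l1_dir_integrable iw.1.
- exact: l1_dir_integrable mh.
- by move=> f fl fh a b b0; exact: (frame_isotropic i10 iZ).
- by move=> t; rewrite vE wE.
split => // t x wx; rewrite /dir dotZl mulr_gt0// invr_gt0 lt_def sqrtr_ge0 andbT.
rewrite -sqrf_eq0 enorm_sqr dot_eq0; apply/eqP => w0.
by move: wx; rewrite w0 dotE big1 ?ltxx// => i _; rewrite mxE mul0r.
Qed.
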